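(* Let $\mu_k\in\mathbb{R}^{n_x}$, $\Sigma_k\in\mathbb{R}^{n_x\times n_x}$ (a covariance matrix), $\mathcal{X}_f^\mu\subset\mathbb{R}^{n_x}$, $\Sigma_f\succ0$ and $P_{\rm mean}\succ0$ be given. Consider, at time step $k$, the finite-horizon stochastic optimal control problem $$\min_{u_{k|k},\dots,u_{k+N-1|k}}\ \mathbb{E}_k\Big[\sum_{t=k}^{k+N-1}x_{t|k}^\top Qx_{t|k}+u_{t|k}^\top Ru_{t|k}\Big]+\mathbb{E}_k[x_{k+N|k}]^\top P_{\rm mean}\,\mathbb{E}_k[x_{k+N|k}]$$ subject to, for $t=k,\dots,k+N-1$, $i=0,\dots,N_s-1$, $j=0,\dots,N_c-1$, $$x_{t+1|k}=Ax_{t|k}+Bu_{t|k}+Dw_t,\qquad x_{k|k}=x_k\sim\mathcal{N}(\mu_k,\Sigma_k),$$ $$\Pr{}_k(\alpha_{x,i}^\top x_{t|k}\le\beta_{x,i})\ge1-p_{x,i},\qquad \Pr{}_k(\alpha_{u,j}^\top u_{t|k}\le\beta_{u,j})\ge1-p_{u,j},$$ $$\mathbb{E}_k[x_{k+N|k}]\in\mathcal{X}_f^\mu,\qquad \mathbb{E}_k\big[(x_{k+N|k}-\mathbb{E}_k[x_{k+N|k}])(x_{k+N|k}-\mathbb{E}_k[x_{k+N|k}])^\top\big]\preceq\Sigma_f.$$ Using the control law $$u_{t|k}=v_{t|k}+K_{t|k}y_{t|k},\qquad y_{t+1|k}=Ay_{t|k}+Dw_t,\qquad y_{k|k}=x_{k|k}-\mu_{k|k},\qquad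 t=k,\dots,k+N-1,$$ where $v_{t|k}\in\mathbb{R}^{n_u}$, $K_{t|k}\in\mathbb{R}^{n_u\times n_x}$ and $y_{t|k}\in\mathbb{R}^{n_x}$, this problem can be cast as the following convex programming problem: $$\min_{V,K}\ J_N(\mu_k,\Sigma_k;V,K)=\mathrm{tr}\Big[\big((I+\mathcal{B}K)^\top\bar Q_{P,\rm cov}(I+\mathcal{B}K)+K^\top\bar RK\big)\Sigma_y\Big]+(\mathcal{A}\mu_{k|k}+\mathcal{B}V)^\top\bar Q_{P,\rm mean}(\mathcal{A}\mu_{k|k}+\mathcal{B}V)+V^\top\bar RV$$ subject to, for all $i=0,\dots,N_s-1$, $j=0,\dots,N_c-1$, $t=k,\dots,k+N-1$, $$\alpha_{x,i}^\top E_{t-k}(\mathcal{A}\mu_{k|k}+\mathcal{B}V)+\|\Sigma_y^{1/2}(I+\mathcal{B}K)^\top E_{t-k}^\top\alpha_{x,i}\|\,\Phi^{-1}(1-p_{x,i})-\beta_{x,i}\le0,$$ $$\alpha_{u,j}^\top F_{t-k}V+\|\Sigma_y^{1/2}K^\top F_{t-k}^\top\alpha_{u,j}\|\,\Phi^{-1}(1-p_{u,j})-\beta_{u,j}\le0,$$ $$E_N(\mathcal{A}\mu_{k|k}+\mathcal{B}V)\in\mathcal{X}_f^\mu,\qquad \Sigma_f\succeq E_N(I+\mathcal{B}K)\Sigma_y(I+\mathcal{B}K)^\top E_N^\top,$$ where $\mu_{k|k}=\mu_k$, $\Sigma_{k|k}=\Sigma_k$, $\Sigma_y=\mathcal{A}\Sigma_{k|k}\mathcal{A}^\top+\mathcal{D}\mathcal{D}^\top$,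 $V=(v_{k|k}^\top,\dots,v_{k+N-1|k}^\top)^\top$, $K=\big[\mathrm{blkdiag}(K_{k|k},\dots,K_{k+N-1|k})\ \ 0\big]\in\mathbb{R}^{Nn_u\times(N+1)n_x}$ (last block column zero), $\bar Q_{P,\rm mean}=\mathrm{blkdiag}(Q,\dots,Q,P_{\rm mean})$, $\bar Q_{P,\rm cov}=\mathrm{blkdiag}(Q,\dots,Q,0)$ ($N$ copies of $Q$ in each) and $\bar R=\mathrm{blkdiag}(R,\dots,R)$ ($N$ copies).
   Context: The underlying system is $x_{k+1}=Ax_k+Bu_k+Dw_k$ with constant known matrices $A\in\mathbb{R}^{n_x\times n_x}$, $B\in\mathbb{R}^{n_x\times n_u}$, $D\in\mathbb{R}^{n_x\times n_w}$; the $w_k\in\mathbb{R}^{n_w}$ are i.i.d. zero-mean Gaussian with $\mathbb{E}[w_{k_1}w_{k_2}^\top]=I_{n_w}\delta_{k_1,k_2}$ (Kronecker delta), and $\mathbb{E}[x_{k_1}w_{k_2}^\top]=0$ for $0\le k_1\le k_2$. The state is perfectly measured. $Q\succeq0$, $R\succ0$, and $N$ is the optimization horizon. The constants $\alpha_{x,i}\in\mathbb{R}^{n_x}$, $\alpha_{u,j}\in\mathbb{R}^{n_u}$, $\beta_{x,i},\beta_{u,j}\in\mathbb{R}$ are given and define the polytopes $\bigcap_{i=0}^{N_s-1}\{x:\alpha_{x,i}^\top x\le\beta_{x,i}\}$ and $\bigcap_{j=0}^{N_c-1}\{u:\alpha_{u,j}^\top u\le\beta_{u,j}\}$, which contain the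 origin. The violation probabilities satisfy $p_{x,i},p_{u,j}\in[0,0.5)$, $\sum_i p_{x,i}\le\epsilon_x$ and $\sum_j p_{u,j}\le\epsilon_u$ with given $\epsilon_x,\epsilon_u\in[0,0.5)$. Standing assumptions: $(A,B)$ is controllable, $N\ge n_x$, and $\mathcal{R}(B)\subseteq\mathcal{R}(D)$ (range spaces). $x_{t|k}$, $u_{t|k}$ denote the state and input at time $t\ge k$ predicted at time $k$. $\mathbb{E}_k[\cdot]=\mathbb{E}[\cdot|x_k]$ and $\Pr_k(\cdot)=\Pr(\cdot|x_k)$ denote expectation and probability given the state information at step $k$, the initial state of the prediction being distributed as $x_{k|k}=x_k\sim\mathcal{N}(\mu_k,\Sigma_k)$. Stacked matrices: $\mathcal{A}\in\mathbb{R}^{(N+1)n_x\times n_x}$, $\mathcal{B}\in\mathbb{R}^{(N+1)n_x\times Nn_u}$, $\mathcal{D}\in\mathbb{R}^{(N+1)n_x\times Nn_w}$ are the matrices for which the stacked state, input and noise vectors over the horizon satisfy $X=\mathcal{A}x_{k|k}+\mathcal{B}U+\mathcal{D}W$. That is, $\mathcal{A}$ has block rows $A^i$, $i=0,\dots,N$, and $\mathcal{B}$ (resp. $\mathcal{D}$) has $(i,j)$ block, $i=0,\dots,N$, $j=0,\dots,N-1$, equal to $A^{i-1-j}B$ (resp. $A^{i-1-j}D$) if $j<i$ and $0$ otherwise. $E_s\in\mathbb{R}^{n_x\times(N+1)n_x}$ ($s=0,\dots,N$) and $F_s\in\mathbb{R}^{n_u\times Nn_u}$ ($s=0,\dots,N-1$)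 select the $s$-th block of a stacked state, respectively input, vector. $\Phi^{-1}$ is the inverse of the cumulative distribution function of the standard normal distribution. $\|\cdot\|$ is the Euclidean norm, $M^{1/2}$ is the symmetric positive semidefinite square root, $\succeq,\preceq,\succ$ refer to the semidefinite order on symmetric matrices, $\mathrm{blkdiag}$ denotes a block-diagonal matrix, and $I$ is the identity of size $(N+1)n_x$.
   Formalization: The initial state and the noises over the horizon are assumed jointly Gaussian (uncorrelatedness alone does not suffice for the chance constraints), and convexity of the terminal-mean constraint and of the feasible set is claimed only when X_f^μ is convex. *)

(* Defs.v *)
From HB Require Import structures.
From mathcomp Require Import all_boot all_order all_algebra.
From mathcomp Require Import all_classical all_reals all_analysis.
From mathcomp Require Import interval_inference.

Set Implicit Arguments.
Unset Strict Implicit.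
Unset Printing Implicit Defensive.

Import Order.TTheory GRing.Theory Num.Theory.
Local Open Scope classical_set_scope.
Local Open Scope ring_scope.
Local Open Scope convex_scope.

Section linear_algebra.
Context {R : realType}.

Definition qform n (M : 'M[R]_n) (v : 'cV[R]_n) : R := (v^T *m M *m v) 0 0.

Definition dot n (a v : 'cV[R]_n) : R := (a^T *m v) 0 0.

Definition psd n (M : 'M[R]_n) : Prop :=
  M^T = M /\ forall v, 0 <= qform M v.

Definition pd n (M : 'M[R]_n) : Prop :=
  M^T = M /\ forall v, v != 0 -> 0 < qform M v.

Definition loewner_le n (M1 M2 : 'M[R]_n) : Prop := psd (M2 - M1).

Definition enorm n (v : 'cV[R]_n) : R := Num.sqrt (\sum_i v i 0 ^+ 2).

(* The default value 0 is only reached when [M] is not positive semidefinite. *)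
Definition psd_sqrt n (M : 'M[R]_n) : 'M[R]_n :=
  xget 0 [set S : 'M[R]_n | psd S /\ S *m S = M].

Fixpoint det_state nx nu (A : 'M[R]_nx) (B : 'M[R]_(nx, nu)) (x0 : 'cV[R]_nx)
    (u : nat -> 'cV[R]_nu) (m : nat) : 'cV[R]_nx :=
  if m is m'.+1 then A *m det_state A B x0 u m' + B *m u m' else x0.

Definition controllable nx nu (A : 'M[R]_nx) (B : 'M[R]_(nx, nu)) : Prop :=
  forall x0 x1 : 'cV[R]_nx, exists m u, det_state A B x0 u m = x1.

Definition polytope n m (alpha : 'I_m -> 'cV[R]_n) (beta : 'I_m -> R) :
    set 'cV[R]_n :=
  [set v | forall i, dot (alpha i) v <= beta i].

End linear_algebra.

Section normal_law.
Context {R : realType}.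

(* Univariate normal law with mean [m] and variance [v].  The degenerate case is
   separated because [normal_prob m 0] is a uniform law, not a Dirac mass. *)
Definition gauss_law (m v : R) : set R -> \bar R :=
  if v == 0 then (\d_m : set R -> \bar R) else normal_prob m (Num.sqrt v).

(* Standard normal cdf on the extended line, a bijection onto [0, 1]. *)
Definition Phi (x : \bar R) : \bar R :=
  normal_prob (0 : R) 1 [set z : R | (z%:E <= x)%E].

(* Extended-valued so that Phi^-1(1) = +oo.  Together with 0 * +oo = 0 in
   [\bar R], this gives a meaning to ||.|| * Phi^-1(1 - p) when p = 0. *)
Definition Phi_inv (p : R) : \bar R := xget 0%E [set x | Phi x = p%:E].

End normal_law.

Section random_vectors.
Context d (Omega : measurableType d) (R : realType) (P : probability Omega R).

Definition random_vector n (X : Omega -> 'cV[R]_n) : Prop :=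
  forall i, measurable_fun setT (fun o => X o i 0).

Definition square_integrable n (X : Omega -> 'cV[R]_n) : Prop :=
  forall i, (fun o => X o i 0) \in Lfun P 2%:E.

Definition mean n (X : Omega -> 'cV[R]_n) : 'cV[R]_n :=
  \col_i fine ('E_P[fun o => (X o i 0)%R])%E.

(* E[X Y^T] *)
Definition cross_moment m n (X : Omega -> 'cV[R]_m) (Y : Omega -> 'cV[R]_n) :
    'M[R]_(m, n) :=
  \matrix_(i, j) fine ('E_P[fun o => (X o i 0 * Y o j 0)%R])%E.

Definition cov_mx n (X : Omega -> 'cV[R]_n) : 'M[R]_n :=
  cross_moment (fun o => X o - mean X) (fun o => X o - mean X).

(* X ~ N(mu, Sigma), possibly degenerate: every linear functional of X is
   univariate normal with the corresponding mean and variance. *)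
Definition gaussian_vector n (X : Omega -> 'cV[R]_n)
    (mu : 'cV[R]_n) (Sigma : 'M[R]_n) : Prop :=
  random_vector X /\
  forall (a : 'cV[R]_n) (C : set R), measurable C ->
    P ((fun o => dot a (X o)) @^-1` C) =
    gauss_law (dot a mu) (qform Sigma a) C.

Definition sigma_rv n (X : Omega -> 'cV[R]_n) : set (set Omega) :=
  <<s [set E | exists i (C : set R),
         measurable C /\ E = (fun o => X o i 0) @^-1` C] >>.

Definition mutually_independent n (T : set nat) (w : nat -> Omega -> 'cV[R]_n) :
    Prop :=
  forall (J : seq nat) (E : nat -> set Omega), uniq J ->
    (forall t, t \in J -> T t /\ sigma_rv (w t) (E t)) ->
    P (\bigcap_(t in [set` J]) E t) = (\prod_(t <- J) P (E t))%E.

(* Being i.i.d. is the common law N(0, I) together with independence. *)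
Record gaussian_white_noise n (k : nat) (w : nat -> Omega -> 'cV[R]_n) : Prop :=
  GaussianWhiteNoise {
    noise_gaussian : forall t, (k <= t)%N -> gaussian_vector (w t) 0 1%:M ;
    noise_independent : mutually_independent [set t | (k <= t)%N] w ;
    noise_white : forall t1 t2, (k <= t1)%N -> (k <= t2)%N ->
      cross_moment (w t1) (w t2) = (t1 == t2)%:R%:M }.

End random_vectors.

(* Dimension of a vector stacking [m] blocks of size [n]. *)
Notation stk m n := (\sum_(i < m) n)%N.

Record ocp_data (R : realType) (nx nu nw N Ns Nc : nat) := OcpData {
  dA : 'M[R]_nx ;
  dB : 'M[R]_(nx, nu) ;
  dD : 'M[R]_(nx, nw) ;
  dQ : 'M[R]_nx ;
  dR : 'M[R]_nu ;
  dPmean : 'M[R]_nx ;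
  alphax : 'I_Ns -> 'cV[R]_nx ;
  betax : 'I_Ns -> R ;
  alphau : 'I_Nc -> 'cV[R]_nu ;
  betau : 'I_Nc -> R ;
  px : 'I_Ns -> R ;
  pu : 'I_Nc -> R ;
  epsx : R ;
  epsu : R ;
  Xf : set 'cV[R]_nx ;
  Sigmaf : 'M[R]_nx ;
  muk : 'cV[R]_nx ;
  Sigmak : 'M[R]_nx }.

Record standing_assumptions (R : realType) (nx nu nw N Ns Nc : nat)
    (q : ocp_data R nx nu nw N Ns Nc) : Prop := StandingAssumptions {
  Q_psd : psd (dQ q) ;
  R_pd : pd (dR q) ;
  Pmean_pd : pd (dPmean q) ;
  Sigmaf_pd : pd (Sigmaf q) ;
  Sigmak_psd : psd (Sigmak q) ;
  origin_x : polytope (alphax q) (betax q) 0 ;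
  origin_u : polytope (alphau q) (betau q) 0 ;
  px_range : forall i, 0 <= px q i < 2^-1 ;
  pu_range : forall j, 0 <= pu q j < 2^-1 ;
  epsx_range : 0 <= epsx q < 2^-1 ;
  epsu_range : 0 <= epsu q < 2^-1 ;
  px_sum : \sum_i px q i <= epsx q ;
  pu_sum : \sum_j pu q j <= epsu q ;
  AB_controllable : controllable (dA q) (dB q) ;
  horizon_ge : (nx <= N)%N ;
  range_BD : range (fun v : 'cV[R]_nu => dB q *m v) `<=`
             range (fun v : 'cV[R]_nw => dD q *m v) }.

Section stochastic_ocp.
Context d (Omega : measurableType d) (R : realType) (P : probability Omega R).
Context (nx nu nw N Ns Nc : nat) (q : ocp_data R nx nu nw N Ns Nc).
Context (k : nat) (xk : Omega -> 'cV[R]_nx) (w : nat -> Omega -> 'cV[R]_nw).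

(* Processes are indexed by absolute time; only the values at times k, ..., k+N
   (states) and k, ..., k+N-1 (inputs, noises) matter. *)
Implicit Types (x : nat -> Omega -> 'cV[R]_nx) (u : nat -> Omega -> 'cV[R]_nu).

Definition predicts x u : Prop :=
  x k = xk /\
  forall s : 'I_N,
    x (k + s).+1 = fun o => dA q *m x (k + s)%N o + dB q *m u (k + s)%N o
                            + dD q *m w (k + s)%N o.

Definition ocp_cost x u : \bar R :=
  ('E_P[fun o => (\sum_(s < N) (qform (dQ q) (x (k + s)%N o)
                               + qform (dR q) (u (k + s)%N o)))%R]
   + (qform (dPmean q) (mean P (x (k + N)%N)))%:E)%E.

(* Square integrability makes all the expectations of the problem finite. *)
Record ocp_feasible x u : Prop := OcpFeasible {
  ocp_admissible : forall s : 'I_N, square_integrable P (u (k + s)%N) ;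
  ocp_dynamics : predicts x u ;
  ocp_chance_x : forall (s : 'I_N) i,
    (P [set o | (dot (alphax q i) (x (k + s)%N o) <= betax q i)%R]
       >= (1 - px q i)%:E)%E ;
  ocp_chance_u : forall (s : 'I_N) j,
    (P [set o | (dot (alphau q j) (u (k + s)%N o) <= betau q j)%R]
       >= (1 - pu q j)%:E)%E ;
  ocp_terminal_mean : Xf q (mean P (x (k + N)%N)) ;
  ocp_terminal_cov : loewner_le (cov_mx P (x (k + N)%N)) (Sigmaf q) }.

End stochastic_ocp.

(* The decision variables (v_{k+s|k})_s and (K_{k+s|k})_s, with s = t - k. *)
Notation decision R nx nu N :=
  ({ffun 'I_N -> 'cV[R]_nu} * {ffun 'I_N -> 'M[R]_(nu, nx)})%type.

Section control_law.
Context d (Omega : measurableType d) (R : realType).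
Context (nx nu nw N Ns Nc : nat) (q : ocp_data R nx nu nw N Ns Nc).
Context (k : nat) (w : nat -> Omega -> 'cV[R]_nw).

Definition follows_law (z : decision R nx nu N)
    (x : nat -> Omega -> 'cV[R]_nx) (u : nat -> Omega -> 'cV[R]_nu) : Prop :=
  exists y : nat -> Omega -> 'cV[R]_nx,
    [/\ y k = (fun o => x k o - muk q),
        forall s : 'I_N,
          y (k + s).+1 = fun o => dA q *m y (k + s)%N o + dD q *m w (k + s)%N o
      & forall s : 'I_N,
          u (k + s)%N = fun o => z.1 s + z.2 s *m y (k + s)%N o].

End control_law.

Section convex_program.
Context (R : realType).
Context (nx nu nw N Ns Nc : nat) (q : ocp_data R nx nu nw N Ns Nc).

Definition calA : 'M[R]_(stk N.+1 nx, nx) := \mxcol_(i < N.+1) (dA q ^+ i).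

Definition lower_toeplitz m (M : 'M[R]_(nx, m)) :
    'M[R]_(stk N.+1 nx, stk N m) :=
  \mxblock_(i < N.+1, j < N)
    (if (j < i)%N then dA q ^+ (i - 1 - j) *m M else 0).

Definition calB : 'M[R]_(stk N.+1 nx, stk N nu) := lower_toeplitz (dB q).
Definition calD : 'M[R]_(stk N.+1 nx, stk N nw) := lower_toeplitz (dD q).

Definition block_sel m n (s : 'I_m) : 'M[R]_(n, stk m n) :=
  \mxrow_(j < m) (if j == s then 1%:M else 0).

Definition Esel (s : 'I_N.+1) : 'M[R]_(nx, stk N.+1 nx) := block_sel nx s.
Definition Fsel (s : 'I_N) : 'M[R]_(nu, stk N nu) := block_sel nu s.

Definition Vvec (z : decision R nx nu N) : 'cV[R]_(stk N nu) :=
  \mxcol_(s < N) z.1 s.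

Definition Kmat (z : decision R nx nu N) : 'M[R]_(stk N nu, stk N.+1 nx) :=
  \mxblock_(i < N, j < N.+1) (if i == j :> nat then z.2 i else 0).

Definition Qmean : 'M[R]_(stk N.+1 nx) :=
  \mxdiag_(i < N.+1) (if (i < N)%N then dQ q else dPmean q).
Definition Qcov : 'M[R]_(stk N.+1 nx) :=
  \mxdiag_(i < N.+1) (if (i < N)%N then dQ q else 0).
Definition Rbar : 'M[R]_(stk N nu) := \mxdiag_(i < N) dR q.

Definition Sigmay : 'M[R]_(stk N.+1 nx) :=
  calA *m Sigmak q *m calA^T + calD *m calD^T.

Definition mean_traj z : 'cV[R]_(stk N.+1 nx) :=
  calA *m muk q + calB *m Vvec z.
Definition IBK z : 'M[R]_(stk N.+1 nx) := 1%:M + calB *m Kmat z.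

Definition JN (z : decision R nx nu N) : R :=
  \tr (((IBK z)^T *m Qcov *m IBK z + (Kmat z)^T *m Rbar *m Kmat z) *m Sigmay)
  + qform Qmean (mean_traj z) + qform Rbar (Vvec z).

Definition state_con (s : 'I_N) (i : 'I_Ns) (z : decision R nx nu N) : \bar R :=
  let Es := Esel (widen_ord (leqnSn N) s) in
  ((dot (alphax q i) (Es *m mean_traj z))%:E
   + (enorm (psd_sqrt Sigmay *m (IBK z)^T *m Es^T *m alphax q i))%:E
     * Phi_inv (1 - px q i)
   - (betax q i)%:E)%E.

Definition input_con (s : 'I_N) (j : 'I_Nc) (z : decision R nx nu N) : \bar R :=
  ((dot (alphau q j) (Fsel s *m Vvec z))%:E
   + (enorm (psd_sqrt Sigmay *m (Kmat z)^T *m (Fsel s)^T *m alphau q j))%:E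
     * Phi_inv (1 - pu q j)
   - (betau q j)%:E)%E.

Definition mean_con : set (decision R nx nu N) :=
  [set z | Xf q (Esel ord_max *m mean_traj z)].

Definition cov_con : set (decision R nx nu N) :=
  [set z | loewner_le (Esel ord_max *m IBK z *m Sigmay *m (IBK z)^T
                       *m (Esel ord_max)^T) (Sigmaf q)].

Definition program_feasible : set (decision R nx nu N) :=
  [set z | [/\ forall s i, (state_con s i z <= 0)%E,
               forall s j, (input_con s j z <= 0)%E,
               mean_con z & cov_con z]].

End convex_program.

Definition convex_efunction (R : realType) (E : lmodType R)
    (f : convex_lmodType E -> \bar R) : Prop :=
  forall (t : {i01 R}) (a b : convex_lmodType E),
    (f (a <| t |> b) <= (t%:num)%:E * f a + (1 - t%:num)%:E * f b)%E.

Definition minimizer (R : realType) (T : Type) (S : set T) (f : T -> \bar R)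
    (a : T) : Prop :=
  S a /\ forall b, S b -> (f a <= f b)%E.

(* Main.v *)
Require Import Defs.
From HB Require Import structures.
From mathcomp Require Import all_boot all_order all_algebra.
From mathcomp Require Import all_classical all_reals all_analysis.
From mathcomp Require Import measurable_realfun complex spectral.
From mathcomp Require Import interval_inference ring lra.

Set Implicit Arguments.
Unset Strict Implicit.
Unset Printing Implicit Defensive.
Import Order.TTheory GRing.Theory Num.Theory.
Import numFieldNormedType.Exports.
Local Open Scope classical_set_scope.
Local Open Scope ring_scope.

(** Let [Y = calA (x_k - mu_k) + calD W] be the stacked response of the process
    [y] of the control law.  Solving the two linear recursions for [y] and for
    [x - y] ([linear_recursion], [closed_loop]) shows that the predicted states
    and inputs are affine in [Y]:

      x_s = E_s (I + calB K) Y + E_s (calA mu_k + calB V),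
      u_s = F_s K Y + F_s V.

    [Y] has mean 0 and covariance [Sigmay] ([Yvec_mean], [Yvec_cov]), and so the
    random problem becomes a statement about the matrices of the program.

    - Cost: E q(G Y + g) = q(g) + tr (G^T M G Sigmay) for the quadratic form [q]
      of [M]; summing over the stages gives [JN] ([closed_loop_cost]).
    - Chance constraints: [x_k] and the noises being jointly Gaussian, each linear
      functional of a state or an input has a law N(m, v), and
      P(N(m, v) <= b) >= 1 - p is m + sqrt v Phi^-1(1 - p) <= b, the degenerate
      cases v = 0 and p = 0 included ([gauss_chanceP]); the deviation sqrt v is
      the norm of the program by [enorm_psd_sqrt].
    - Terminal constraints: the mean and the covariance of [x_N] are those of an
      affine image of [Y].

    Thus a pair (x, u) that follows the law of a decision [z] is feasible, with
    cost [JN z], exactly when [z] is feasible for the program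
    ([closed_loop_feasible]), and every [z] has such a pair
    ([closed_loop_exists]); optimal values and minimizers therefore agree.

    Convexity holds because [V], [K], [mean_traj] and [IBK] are affine in the
    decision: [JN] is then a sum of positive semidefinite quadratic forms; a
    chance constraint is an affine function plus a norm times a quantile, which
    is nonnegative since p < 1/2 ([chance_convex]); and the terminal covariance
    is matrix convex ([cov_con_convex]).

    Three facts of independent interest support this.  A real positive
    semidefinite matrix has a positive semidefinite square root, obtained as a
    polynomial in the matrix ([psd_sqrt_exists]).  The mean and variance of a
    normal density come from the derivative of [x phi(x)] and symmetry
    ([normal_centered_moment]).  The standard normal distribution function is a
    strictly increasing map of the extended line onto [0, 1] ([Phi_lt],
    [Phi_surj]), so that quantiles exist and order like probabilities. *)

(** * Quadratic forms and square roots of positive semidefinite matrices *)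

Lemma poly_interpolation (F : fieldType) (f : F -> F) (s : seq F) :
  exists p : {poly F}, {in s, forall x, p.[x] = f x}.
Proof.
elim: s => [|a s [p ps]]; first by exists 0.
have [as_|as_] := boolP (a \in s).
  by exists p => x; rewrite inE => /orP[/eqP->|]; exact: ps.
pose q := \prod_(x <- s) ('X - x%:P).
have qa : q.[a] != 0 by move: as_; rewrite -root_prod_XsubC.
exists (p + ((f a - p.[a]) / q.[a]) *: q) => x.
rewrite inE hornerD hornerZ => /orP[/eqP->|xs]; first by rewrite divfK// addrC subrK.
have /rootP-> : root q x by rewrite root_prod_XsubC.
by rewrite mulr0 addr0 ps.
Qed.

Lemma trmx_horner_mx (F : comNzRingType) n (M : 'M[F]_n.+1) (p : {poly F}) :
  M^T = M -> (horner_mx M p)^T = horner_mx M p.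
Proof.
move=> MT; elim/poly_ind: p => [|p c IH]; first by rewrite !rmorph0 trmx0.
rewrite rmorphD rmorphM /= horner_mx_X horner_mx_C linearD/= tr_scalar_mx.
rewrite -[_ * M]/(horner_mx M p *m M) trmx_mul IH MT.
by congr (_ + _); exact: (comm_mx_horner p (erefl (M *m M))).
Qed.

Section quadratic_forms.
Context {R : realType}.

Lemma dotE n (a v : 'cV[R]_n) : dot a v = \sum_i a i 0 * v i 0.
Proof. by rewrite /dot mxE; apply: eq_bigr => i _; rewrite mxE. Qed.

Lemma dotvv n (v : 'cV[R]_n) : dot v v = \sum_i v i 0 ^+ 2.
Proof. by rewrite dotE; apply: eq_bigr => i _; rewrite expr2. Qed.

Lemma enormE n (v : 'cV[R]_n) : enorm v = Num.sqrt (dot v v).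
Proof. by rewrite dotvv. Qed.

Lemma dotvv_ge0 n (v : 'cV[R]_n) : 0 <= dot v v.
Proof. by rewrite dotvv; apply: sumr_ge0 => i _; rewrite sqr_ge0. Qed.

Lemma dotvv_gt0 n (v : 'cV[R]_n) : v != 0 -> 0 < dot v v.
Proof.
move=> v0; rewrite lt_neqAle dotvv_ge0 andbT eq_sym; apply: contra v0.
rewrite dotvv psumr_eq0; last by move=> i _; rewrite sqr_ge0.
move=> /allP v0; apply/eqP/matrixP => i j; rewrite !ord1 mxE.
by apply/eqP; move: (v0 i (mem_index_enum _)); rewrite sqrf_eq0.
Qed.

Lemma qform_mulmx m n (M : 'M[R]_m) (A : 'M[R]_(m, n)) v :
  qform M (A *m v) = qform (A^T *m M *m A) v.
Proof. by rewrite /qform trmx_mul !mulmxA. Qed.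

Lemma qformD n (M1 M2 : 'M[R]_n) v : qform (M1 + M2) v = qform M1 v + qform M2 v.
Proof. by rewrite /qform mulmxDr mulmxDl mxE. Qed.

Lemma qformN n (M : 'M[R]_n) v : qform (- M) v = - qform M v.
Proof. by rewrite /qform mulmxN mulNmx mxE. Qed.

Lemma qform_sum (I : finType) n (M : I -> 'M[R]_n) v :
  qform (\sum_i M i) v = \sum_i qform (M i) v.
Proof. by rewrite /qform mulmx_sumr mulmx_suml summxE. Qed.

Lemma qform_scale n (M : 'M[R]_n) a v : qform M (a *: v) = a ^+ 2 * qform M v.
Proof.
by rewrite /qform [(_ *: v)^T]linearZ/= -!scalemxAl -scalemxAr !mxE mulrA expr2.
Qed.

Lemma qform1 n (v : 'cV[R]_n) : qform 1%:M v = dot v v.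
Proof. by rewrite /qform mulmx1. Qed.

Lemma psd_congr m n (M : 'M[R]_m) (A : 'M[R]_(m, n)) :
  psd M -> psd (A^T *m M *m A).
Proof.
move=> [MT M0]; split; first by rewrite !trmx_mul trmxK MT mulmxA.
by move=> v; rewrite -qform_mulmx.
Qed.

Lemma psdD n (M1 M2 : 'M[R]_n) : psd M1 -> psd M2 -> psd (M1 + M2).
Proof.
move=> [T1 P1] [T2 P2]; split; first by rewrite linearD/= T1 T2.
by move=> v; rewrite qformD addr_ge0.
Qed.

Lemma pd_psd n (M : 'M[R]_n) : pd M -> psd M.
Proof.
move=> [T P]; split=> // v; have [->|v0] := eqVneq v 0; last exact/ltW/P.
by rewrite /qform mulmx0 mxE.
Qed.

Lemma psd1 n : psd (1%:M : 'M[R]_n).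
Proof. by split; [rewrite trmx1 | move=> v; rewrite qform1 dotvv_ge0]. Qed.

Lemma qform_polarize n (M : 'M[R]_n) (u v : 'cV[R]_n) : M^T = M ->
  qform M (u + v) = qform M u + qform M v + 2 * (u^T *m M *m v) 0 0.
Proof.
move=> MT; rewrite /qform [(u + v)^T]linearD/= !mulmxDl !mulmxDr.
have -> : v^T *m M *m u = (u^T *m M *m v)^T by rewrite !trmx_mul trmxK MT mulmxA.
move: (u^T *m M *m u) (v^T *m M *m v) (u^T *m M *m v) => A B C.
by rewrite !mxE; ring.
Qed.

Lemma qform_lincomb n (M : 'M[R]_n) (u v : 'cV[R]_n) (s t : R) : M^T = M ->
  qform M (s *: u + t *: v) = s ^+ 2 * qform M u + t ^+ 2 * qform M v +
    2 * (s * t * (u^T *m M *m v) 0 0).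
Proof.
move=> MT; rewrite qform_polarize// !qform_scale; congr (_ + 2 * _).
by rewrite [(s *: u)^T]linearZ/= -!scalemxAl -scalemxAr !mxE mulrA.
Qed.

(** The convexity defect is [t (1 - t) (u - v)^T M (u - v)]. *)
Lemma qform_convex n (M : 'M[R]_n) (u v : 'cV[R]_n) (t : R) : psd M ->
  0 <= t <= 1 ->
  qform M (t *: u + (1 - t) *: v) <= t * qform M u + (1 - t) * qform M v.
Proof.
move=> [MT M0] /andP[t0 t1].
have tt : 0 <= t * (1 - t) by rewrite mulr_ge0// subr_ge0.
have := mulr_ge0 tt (M0 (1 *: u + (-1) *: v)).
rewrite !qform_lincomb//; lra.
Qed.

(** Polarization makes the quadratic form determine a symmetric matrix. *)
Lemma sym_qform_inj n (M1 M2 : 'M[R]_n) : M1^T = M1 -> M2^T = M2 ->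
  (forall a, qform M1 a = qform M2 a) -> M1 = M2.
Proof.
move=> T1 T2 E; apply/matrixP => i j.
have entry (M : 'M[R]_n) :
    ((delta_mx i 0 : 'cV_n)^T *m M *m (delta_mx j 0 : 'cV_n)) 0 0 = M i j.
  by rewrite trmx_delta -rowE -colE !mxE.
have := E (delta_mx i 0 + delta_mx j 0).
by rewrite !qform_polarize// !E !entry; lra.
Qed.

End quadratic_forms.

Section psd_square_root.
Context {R : realType}.
Local Notation toC := (real_complex R).

(** Over [R[i]] the matrix is Hermitian, hence unitarily diagonalizable with real
    eigenvalues. *)
Lemma sym_real_diagonalizable n (M : 'M[R]_n) : M^T = M ->
  exists (P : 'M[R[i]]_n) (r : 'rV[R]_n), P \in unitmx /\
    map_mx toC M = invmx P *m diag_mx (map_mx toC r) *m P.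
Proof.
move=> MT; pose MC := map_mx toC M.
have Msym : MC \is symmetricmx.
  apply/is_hermitianmxP; rewrite expr0 scale1r map_mx_id//.
  by rewrite /MC map_trmx MT.
have Mreal : MC \is a realmx.
  by apply/mxOverP => i j; rewrite mxE; apply/complex_realP; exists (M i j).
have Mh := realsym_hermsym Msym Mreal.
have /orthomx_spectralP specE := hermitian_normalmx Mh.
have /mxOverP dr := hermitian_spectral_diag_real Mh.
exists (spectralmx MC), (map_mx (@complex.Re R) (spectral_diag MC)).
split; first exact: spectral_unit.
have -> : map_mx toC (map_mx (@complex.Re R) (spectral_diag MC)) = spectral_diag MC.
  by apply/matrixP => i j; rewrite !mxE; exact/RRe_real/dr.
exact: specE.
Qed.

Lemma psd_real_eigenvalue n (M : 'M[R]_n) a :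
  (forall v, 0 <= qform M v) -> M^T = M -> eigenvalue M a -> 0 <= a.
Proof.
move=> M0 MT /eigenvalueP[v vM v0].
have vT0 : v^T != 0 by rewrite trmx_eq0.
rewrite -(pmulr_lge0 _ (dotvv_gt0 vT0)); have := M0 v^T.
by rewrite /qform /dot trmxK vM -scalemxAl mxE.
Qed.

(** The eigenvalues [r i] are real and nonnegative, so some real polynomial [p]
    takes the value [r i ^ (1/4)] at each of them.  Then [p(M)^2] squares to [M]
    and is positive semidefinite, being the square of a symmetric matrix. *)
Lemma psd_sqrt_exists n (M : 'M[R]_n) : psd M -> exists S, psd S /\ S *m S = M.
Proof.
case: n M => [|n] M [MT M0].
  by exists 0; split; [split => [|v]; [rewrite trmx0|rewrite /qform mxE big_ord0]|
    apply/matrixP => -[]].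
have [P [r [Pu MC]]] := sym_real_diagonalizable MT.
have r0 i : 0 <= r 0 i.
  apply: (psd_real_eigenvalue M0 MT); rewrite -(eigenvalue_map toC).
  apply/eigenvalueP; exists (row i P).
    rewrite -row_mul MC !mulmxA mulmxV// mul1mx.
    by rewrite row_mul row_diag_mx -scalemxAl mxE -rowE.
  apply/negP => /eqP Pi0.
  have := congr1 (mulmx^~ (invmx P)) Pi0.
  rewrite mul0mx rowE -mulmxA mulmxV// mulmx1 => /matrixP/(_ 0 i).
  by rewrite !mxE !eqxx => /eqP; rewrite oner_eq0.
have [p pr] := poly_interpolation (fun x => Num.sqrt (Num.sqrt x))
                 [seq r 0 i | i <- enum 'I_n.+1].
have {}pr i : p.[r 0 i] ^+ 4 = r 0 i.
  rewrite pr; last by apply: map_f; rewrite mem_enum.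
  by rewrite (exprM _ 2 2) !sqr_sqrtr// sqrtr_ge0.
pose q := horner_mx M p.
have qT : q^T = q by exact: trmx_horner_mx.
exists (q *m q); split.
  rewrite -{1}qT -[X in X *m q]mulmx1; apply: psd_congr; exact: psd1.
suff: map_mx toC (q *m q *m (q *m q)) = map_mx toC M by exact: map_mx_inj.
have qC : map_mx toC q = invmx P *m diag_mx (map_mx (horner (map_poly toC p))
             (map_mx toC r)) *m P.
  rewrite -horner_mx_diag -(horner_mx_uconjC _ _ Pu) -MC; exact: map_horner_mx.
rewrite !map_mxM /= qC MC.
set d := map_mx (horner _) _.
rewrite -!mulmxA; congr (_ *m _); rewrite !mulmxA; congr (_ *m _).
rewrite !(mulmxK Pu) !mulmx_diag; congr diag_mx.
apply/matrixP => i j; rewrite ord1 !mxE horner_map/= -[RHS]/(toC _) -{5}(pr j).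
by rewrite -!rmorphM/= !exprSr expr0 mul1r.
Qed.

Lemma psd_sqrtP n (M : 'M[R]_n) : psd M ->
  psd (psd_sqrt M) /\ psd_sqrt M *m psd_sqrt M = M.
Proof.
by move=> /psd_sqrt_exists[S HS]; rewrite /psd_sqrt; case: xgetP => // /(_ S).
Qed.

(** Through this identity the norms of the convex program are the standard
    deviations of the constrained quantities. *)
Lemma enorm_psd_sqrt n (M : 'M[R]_n) v : psd M ->
  enorm (psd_sqrt M *m v) = Num.sqrt (qform M v).
Proof.
move=> /psd_sqrtP[[ST _] SS]; congr Num.sqrt.
by rewrite -dotvv -qform1 qform_mulmx ST mulmx1 SS.
Qed.

End psd_square_root.

Section euclidean_norm.
Context {R : realType}.

Lemma enorm_ge0 n (v : 'cV[R]_n) : 0 <= enorm v.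
Proof. exact: sqrtr_ge0. Qed.

Lemma enorm_sqr n (v : 'cV[R]_n) : enorm v ^+ 2 = dot v v.
Proof. by rewrite enormE sqr_sqrtr// dotvv_ge0. Qed.

Lemma enorm_eq0 n (v : 'cV[R]_n) : enorm v = 0 -> v = 0.
Proof.
move=> v0; apply/eqP; apply: contraT => /dotvv_gt0.
by rewrite -enorm_sqr v0 expr0n ltxx.
Qed.

Lemma enormZ n (a : R) (v : 'cV[R]_n) : 0 <= a -> enorm (a *: v) = a * enorm v.
Proof.
move=> a0; rewrite !enormE -!qform1 qform_scale sqrtrM ?sqr_ge0//.
by rewrite sqrtr_sqr ger0_norm.
Qed.

Lemma dotvvD n (u v : 'cV[R]_n) : dot (u + v) (u + v) = dot u u + 2 * dot u v + dot v v.
Proof.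
rewrite -!qform1 qform_polarize ?trmx1// !qform1 mulmx1 /dot; ring.
Qed.

Lemma cauchy_schwarz n (u v : 'cV[R]_n) : dot u v <= enorm u * enorm v.
Proof.
have [u0|u0] := eqVneq (enorm u) 0.
  by rewrite u0 mul0r (enorm_eq0 u0) dotE big1// => i _; rewrite mxE mul0r.
have [v0|v0] := eqVneq (enorm v) 0.
  by rewrite v0 mulr0 (enorm_eq0 v0) dotE big1// => i _; rewrite mxE mulr0.
have uv0 : 0 < enorm u * enorm v.
  by rewrite mulr_gt0// lt_neqAle enorm_ge0 andbT eq_sym.
(* this combination vanishes exactly in the case of equality *)
have := dotvv_ge0 (enorm v *: u + (- enorm u) *: v).
rewrite dotvvD -!qform1 !qform_scale !qform1 -!enorm_sqr.
have -> : dot (enorm v *: u) (- enorm u *: v) = - (enorm u * enorm v) * dot u v.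
  by rewrite !dotE mulr_sumr; apply: eq_bigr => i _; rewrite !mxE; ring.
move=> h; rewrite -(ler_pM2l uv0); move: h; nra.
Qed.

Lemma enormD n (u v : 'cV[R]_n) : enorm (u + v) <= enorm u + enorm v.
Proof.
rewrite -(@ler_pXn2r _ 2)// ?nnegrE ?enorm_ge0 ?addr_ge0 ?enorm_ge0//.
rewrite enorm_sqr dotvvD -!enorm_sqr.
by have := cauchy_schwarz u v; nra.
Qed.

End euclidean_norm.

(** * Moments of the normal density *)

Section normal_density.
Context {R : realType}.
Local Notation mu := (@lebesgue_measure R).
Local Notation phi := (@normal_pdf R 0 1).
Implicit Types m s x c : R.

Lemma normal_pdf_affine m s x : 0 < s -> normal_pdf m s (s * x + m) * s = phi x.
Proof.
move=> s0; have sN0 : s != 0 by rewrite gt_eqF.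
rewrite !normal_pdfE ?oner_eq0// /normal_peak /normal_fun addrK subr0.
rewrite mulrAC; congr (_ * expR _).
  rewrite expr1n mul1r -mulrnAr sqrtrM ?sqr_ge0// sqrtr_sqr gtr0_norm//.
  by rewrite invfM mulrAC mulVf// mul1r.
by rewrite expr1n exprMn; field.
Qed.

Lemma normal_pdf_gt0 m s x : s != 0 -> 0 < normal_pdf m s x.
Proof. by move=> s0; rewrite normal_pdfE// mulr_gt0 ?normal_peak_gt0 ?expR_gt0. Qed.

Lemma phi_sym x : phi (- x) = phi x.
Proof. by rewrite !normal_pdfE ?oner_eq0// /normal_fun !subr0 sqrrN. Qed.

Lemma is_derive_affine m s x : is_derive x (1:R) (fun x => s * x + m) s.
Proof.
apply: (@is_derive_eq _ _ _ (s *: (@id R) + cst m) x 1 s (s *: 1 + 0)).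
by rewrite addr0 /GRing.scale/= mulr1.
Qed.

Lemma derive1_affine m s : (fun x => s * x + m)^`()%classic = cst s.
Proof.
apply/funext => x; have := is_derive_affine m s x => d.
by rewrite derive1E derive_val.
Qed.

Lemma integral_affine (G : R -> R) (m s : R) : 0 < s -> continuous G ->
  (forall x, 0 <= G x) ->
  (\int[mu]_x (G x)%:E = \int[mu]_x (G (s * x + m) * s)%:E)%E.
Proof.
move=> s0 cG G0; have F'E := derive1_affine m s.
have dF := is_derive_affine m s.
rewrite (@increasing_ge0_integration_by_substitutionT _ (fun x => s * x + m) G)//.
- by apply: eq_integral => x _; rewrite F'E.
- by move=> x y xy; rewrite ltrD2r ltr_pM2l.
- by rewrite F'E => ?; exact: cvg_cst.
- by rewrite F'E; exact: is_cvg_cst.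
- by rewrite F'E; exact: is_cvg_cst.
- apply: cvg_comp (cvg_addrr_Ny m); exact: gt0_cvgMrNy.
- apply: cvg_comp (cvg_addrr m); exact: gt0_cvgMry.
Qed.

Lemma integral_oppr (G : R -> R) : continuous G -> (forall x, 0 <= G x) ->
  (\int[mu]_x (G (- x))%:E = \int[mu]_x (G x)%:E)%E.
Proof.
move=> cG G0.
have cGN : continuous (G \o -%R).
  by move=> x; apply: continuous_comp; [exact: oppr_continuous|exact: cG].
have split (F : R -> R) : continuous F -> (forall x, 0 <= F x) ->
    (\int[mu]_x (F x)%:E =
     \int[mu]_(x in `]-oo, 0%R]) (F x)%:E + \int[mu]_(x in `[0%R, +oo[) (F x)%:E)%E.
  move=> cF F0; have mF : measurable_fun setT F by exact: continuous_measurable_fun.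
  rewrite -[X in (_ + X)%E]integral_itv_obnd_cbnd; last first.
    exact/measurable_EFinP/measurable_funTS.
  have -> : [set: R] = `]-oo, 0] `|` `]0, +oo[.
    by apply/seteqP; split => x //= _; rewrite !in_itv/= andbT; case: leP; [left|right].
  rewrite ge0_integral_setU//=.
  - by apply/measurable_EFinP/measurable_funTS.
  - by move=> x _; rewrite lee_fin.
  - apply/disj_setPLR => x; rewrite /= !in_itv/= andbT => x0; apply/negP.
    by rewrite -leNgt.
have half (F : R -> R) : continuous F -> (forall x, 0 <= F x) ->
    (\int[mu]_(x in `]-oo, 0%R]) (F x)%:E =
     \int[mu]_(x in `[0%R, +oo[) (F (- x))%:E)%E.
  move=> cF F0; have := @ge0_integration_by_substitutionNy R F 0.
  by rewrite oppr0; apply => //; exact: continuous_subspaceT.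
have GN0 x : 0 <= (G \o -%R) x by exact: G0.
rewrite (split _ cG G0) (half _ cG G0) (split _ cGN GN0) (half _ cGN GN0) addeC.
by congr (_ + _)%E; apply: eq_integral => x _ /=; rewrite opprK.
Qed.

Lemma measurable_phi : measurable_fun setT phi.
Proof. exact: measurable_normal_pdf. Qed.

Lemma continuous_phi : continuous phi.
Proof. by apply: continuous_normal_pdf; rewrite oner_eq0. Qed.

Lemma phi_ge0 x : 0 <= phi x. Proof. exact: normal_pdf_ge0. Qed.

Lemma phiE : phi = fun x => normal_peak 1 * expR (- 2^-1 * x ^+ 2).
Proof.
apply/funext => x; rewrite normal_pdfE ?oner_eq0// /normal_fun subr0 expr1n.
by congr (_ * expR _); field.
Qed.

Lemma is_derive_phi x : is_derive x (1:R) phi (- x * phi x).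
Proof.
rewrite phiE.
have d1 : is_derive x (1:R) (fun x => - 2^-1 * x ^+ 2) (- x).
  apply: (@is_derive_eq _ _ _ ((- 2^-1) *: (@id R) ^+ 2) x 1).
  by rewrite /GRing.scale/= expr1; field.
apply: (@is_derive_eq _ _ _ (normal_peak 1 *: (expR \o (fun x => - 2^-1 * x ^+ 2))) x 1).
by rewrite /GRing.scale/=; ring.
Qed.

(** The antiderivative that compares the integrals of [x ^+ 2 * phi x] and of
    [phi x]. *)
Lemma is_derive_xphi c x :
  is_derive x (1:R) (fun x => c * x * phi x) (c * (1 - x ^+ 2) * phi x).
Proof.
have := is_derive_phi x => d.
apply: (@is_derive_eq _ _ _ ((c *: (@id R)) * phi) x 1).
by rewrite /GRing.scale/= -[c *: x]/(c * x); ring.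
Qed.

Lemma cvg_xphi : (- x * phi x) @[x --> +oo] --> (0 : R).
Proof.
rewrite phiE; set c := normal_peak 1.
have c0 : 0 < c by rewrite normal_peak_gt0// oner_eq0.
apply/cvgrPdist_lt => e e0; near=> x.
have x0 : 0 < x by near: x; apply: nbhs_pinfty_gt; exact: num_real.
rewrite sub0r mulNr opprK ger0_norm ?mulr_ge0 ?expR_ge0 ?ltW//.
(* the tail is at most [2 c / x] *)
have : 2^-1 * x ^+ 2 <= expR (2^-1 * x ^+ 2).
  by apply: le_trans (expR_ge1Dx _); rewrite lerDr.
rewrite mulNr expRN -lef_pV2 ?posrE ?expR_gt0 ?pmulr_rgt0 ?exprn_gt0//.
move=> h; apply: (@le_lt_trans _ _ (x * (c * (2^-1 * x ^+ 2)^-1))).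
  apply: ler_wpM2l; first exact: ltW.
  by apply: ler_wpM2l => //; exact: ltW.
have -> : x * (c * (2^-1 * x ^+ 2)^-1) = 2 * c / x by field; rewrite gt_eqF.
rewrite ltr_pdivrMr// -ltr_pdivrMl//.
by near: x; apply: nbhs_pinfty_gt; exact: num_real.
Unshelve. all: end_near. Qed.

Lemma continuous_xphi c : continuous (fun x => c * x * phi x).
Proof.
move=> x; have := is_derive_xphi c x => d.
by apply/differentiable_continuous/derivable1_diffP/ex_derive.
Qed.

Lemma continuous_polyphi (p : {poly R}) : continuous (fun x => p.[x] * phi x).
Proof.
by move=> x; apply: cvgM; [exact: continuous_horner|exact: continuous_phi].
Qed.

(** The integrand [(1 - x ^+ 2) * phi x] changes sign at 1, and the fundamental
    theorem of calculus on an unbounded interval asks for a constant sign: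
    hence the cut at 1 in the next two lemmas. *)
Lemma phi_itv01 :
  (\int[mu]_(x in `[0%R, 1%R]) ((1 - x ^+ 2) * phi x)%:E = (phi 1)%:E)%E.
Proof.
rewrite (@continuous_FTC2 _ _ (fun x => 1 * x * phi x))//.
- by rewrite !mulr1 mul1r mulr0 mul0r sube0.
- apply: continuous_subspaceT; have := @continuous_polyphi (1 - 'X^2).
  by under eq_fun do rewrite !hornerE.
- split.
  + by move=> x _; have := is_derive_xphi 1 x => d; exact: ex_derive.
  + exact/cvg_at_right_filter/continuous_xphi.
  + exact/cvg_at_left_filter/continuous_xphi.
- move=> x _; rewrite derive1E; have := is_derive_xphi 1 x => d.
  by rewrite derive_val mul1r.
Qed.

Lemma phi_itv1y :
  (\int[mu]_(x in `[1%R, +oo[) ((x ^+ 2 - 1) * phi x)%:E = (phi 1)%:E)%E.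
Proof.
rewrite (@ge0_continuous_FTC2y _ _ (fun x => -1 * x * phi x) _ 0)//.
- by rewrite mulr1 mulN1r sub0e EFinN oppeK.
- by move=> x x1; rewrite mulr_ge0 ?phi_ge0// subr_ge0 exprn_ege1.
- apply: continuous_subspaceT; have := @continuous_polyphi ('X^2 - 1).
  by under eq_fun do rewrite !hornerE.
- by under eq_fun do rewrite mulN1r; exact: cvg_xphi.
- by move=> x _; have := is_derive_xphi (-1) x => d; exact: ex_derive.
- exact/cvg_at_right_filter/continuous_xphi.
- move=> x _; rewrite derive1E; have := is_derive_xphi (-1) x => d.
  by rewrite derive_val mulN1r opprB.
Qed.

Lemma measurable_polyphi (p : {poly R}) (f : R -> R) (D : set R) :
  f =1 horner p -> measurable_fun D (fun x => (f x * phi x)%:E).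
Proof.
move=> /funext ->; apply/measurable_EFinP; apply: measurable_funTS.
by apply: continuous_measurable_fun; exact: continuous_polyphi.
Qed.

Let msqr (D : set R) : measurable_fun D (fun x => (x ^+ 2 * phi x)%:E).
Proof. by apply: (@measurable_polyphi 'X^2) => x; rewrite hornerXn. Qed.

Let m1 (D : set R) : measurable_fun D (fun x => (phi x)%:E).
Proof.
apply/measurable_EFinP; apply: measurable_funTS; exact: measurable_phi.
Qed.

Lemma phi_second_moment0y :
  (\int[mu]_(x in `[0%R, +oo[) (x ^+ 2 * phi x)%:E =
   \int[mu]_(x in `[0%R, +oo[) (phi x)%:E)%E.
Proof.
have split (F : R -> R) : (forall x, 0 <= F x) ->
    (forall D, measurable_fun D (fun x => (F x)%:E)) ->
    (\int[mu]_(x in `[0%R, +oo[) (F x)%:E = \int[mu]_(x in `[0%R, 1%R]) (F x)%:E +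
       \int[mu]_(x in `]1%R, +oo[) (F x)%:E)%E.
  move=> F0 mF; have -> : `[0, +oo[%classic = `[0, 1] `|` `]1, +oo[ :> set R.
    apply/seteqP; split => x /=; rewrite !in_itv/= !andbT.
      by move=> ->; case: (leP x 1); [left|right].
    by move=> [/andP[]//|/ltW]; exact: le_trans.
  rewrite ge0_integral_setU//=; [exact: mF|by move=> x _; rewrite lee_fin|].
  apply/disj_setPLR => x; rewrite /= !in_itv/= andbT => /andP[_ x1]; apply/negP.
  by rewrite -leNgt.
rewrite (split (fun x => x ^+ 2 * phi x)) => [|x|]; last 2 first.
- by rewrite mulr_ge0 ?phi_ge0 ?sqr_ge0.
- exact: msqr.
rewrite (split phi) => [|x|]; last 2 first.
- exact: phi_ge0.
- exact: m1.
have -> : (\int[mu]_(x in `[0%R, 1%R]) (phi x)%:E =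
    \int[mu]_(x in `[0%R, 1%R]) (x ^+ 2 * phi x)%:E + (phi 1)%:E)%E.
  rewrite -phi_itv01 -ge0_integralD//=.
  - by apply: eq_integral => x _; rewrite -EFinD; congr EFin; ring.
  - by move=> x _; rewrite lee_fin mulr_ge0 ?phi_ge0 ?sqr_ge0.
  - exact: msqr.
  - move=> x; rewrite in_itv/= => /andP[x0 x1].
    by rewrite lee_fin mulr_ge0 ?phi_ge0// subr_ge0 exprn_ile1.
  - by apply: (@measurable_polyphi (1 - 'X^2)) => x; rewrite !hornerE.
have -> : (\int[mu]_(x in `]1%R, +oo[) (x ^+ 2 * phi x)%:E =
    \int[mu]_(x in `]1%R, +oo[) (phi x)%:E + (phi 1)%:E)%E.
  rewrite -phi_itv1y.
  have mX : forall D, measurable_fun D (fun x => ((x ^+ 2 - 1) * phi x)%:E).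
    by move=> D; apply: (@measurable_polyphi ('X^2 - 1)) => x; rewrite !hornerE.
  rewrite -integral_itv_obnd_cbnd; last exact: mX.
  rewrite -ge0_integralD//=.
  - by apply: eq_integral => x _; rewrite -EFinD; congr EFin; ring.
  - by move=> x _; rewrite lee_fin phi_ge0.
  - exact: m1.
  - move=> x; rewrite in_itv/= andbT => x1.
    by rewrite lee_fin mulr_ge0 ?phi_ge0// subr_ge0 exprn_ege1// ltW.
  - exact: mX.
by rewrite addeA addeAC.
Qed.

Lemma phi_second_moment : (\int[mu]_x (x ^+ 2 * phi x)%:E = 1%:E)%E.
Proof.
rewrite -(integral_normal_pdf (0:R) 1) !ge0_symfun_integralT.
- by rewrite -set_itvcy phi_second_moment0y.
- exact: phi_ge0.
- exact: continuous_phi.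
- by move=> x /=; rewrite phi_sym.
- by move=> x; rewrite mulr_ge0 ?phi_ge0 ?sqr_ge0.
- by have := @continuous_polyphi ('X^2); under eq_fun do rewrite !hornerE.
- by move=> x /=; rewrite phi_sym sqrrN.
Qed.

(** [c] and [- c] give the same integral by symmetry of [phi], and averaging the
    two cancels the first moment. *)
Lemma phi_centered_moment c :
  (\int[mu]_x ((x - c) ^+ 2 * phi x)%:E = (1 + c ^+ 2)%:E)%E.
Proof.
have sqp0 (a x : R) : 0 <= (x - a) ^+ 2 * phi x by rewrite mulr_ge0 ?phi_ge0 ?sqr_ge0.
have sqpc (a : R) : continuous (fun x => (x - a) ^+ 2 * phi x).
  by have := @continuous_polyphi (('X - a%:P) ^+ 2); under eq_fun do rewrite !hornerE.
have msqp (a : R) : measurable_fun setT (fun x => ((x - a) ^+ 2 * phi x)%:E).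
  by apply: (@measurable_polyphi (('X - a%:P) ^+ 2)) => x; rewrite !hornerE.
set T := (LHS).
have TN : T = (\int[mu]_x ((x - - c) ^+ 2 * phi x)%:E)%E.
  rewrite -[RHS](integral_oppr (sqpc _) (sqp0 _)); apply: eq_integral => x _.
  by rewrite phi_sym; congr EFin; ring.
have : (T + T = (2 * (1 + c ^+ 2))%:E)%E.
  rewrite {1}TN -ge0_integralD//=; last 4 first.
  - by move=> x _; rewrite lee_fin.
  - exact: msqp.
  - by move=> x _; rewrite lee_fin.
  - exact: msqp.
  transitivity (\int[mu]_x (2%:E * (x ^+ 2 * phi x)%:E +
                            (2 * c ^+ 2)%:E * (phi x)%:E))%E.
    by apply: eq_integral => x _; rewrite -!EFinM -!EFinD; congr EFin; ring.
  rewrite ge0_integralD//=; last 4 first.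
  - by move=> x _; apply: mule_ge0; rewrite ?lee_fin// mulr_ge0 ?phi_ge0 ?sqr_ge0.
  - apply: measurable_funeM; exact: msqr.
  - by move=> x _; apply: mule_ge0; rewrite lee_fin ?phi_ge0// mulr_ge0 ?sqr_ge0.
  - apply: measurable_funeM; exact: m1.
  rewrite ge0_integralZl//=; last 2 first.
  - exact: msqr.
  - by move=> x _; rewrite lee_fin mulr_ge0 ?phi_ge0 ?sqr_ge0.
  rewrite ge0_integralZl//=; last 3 first.
  - exact: m1.
  - by move=> x _; rewrite lee_fin phi_ge0.
  - by rewrite lee_fin mulr_ge0// sqr_ge0.
  by rewrite phi_second_moment integral_normal_pdf -!EFinM -EFinD; congr EFin; ring.
by clear TN; case: T => [t| |]// [] tt; congr EFin; lra.
Qed.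

(** A free center [c] keeps the integrand nonnegative, and yet the identity for
    all [c] determines both the mean and the variance. *)
Lemma normal_centered_moment m s c : 0 < s ->
  (\int[mu]_x ((x - c) ^+ 2 * normal_pdf m s x)%:E = ((m - c) ^+ 2 + s ^+ 2)%:E)%E.
Proof.
move=> s0.
rewrite (@integral_affine _ m s s0).
- transitivity (\int[mu]_x ((s ^+ 2)%:E * ((x - (c - m) / s) ^+ 2 * phi x)%:E))%E.
    apply: eq_integral => x _; rewrite -EFinM -mulrA normal_pdf_affine// mulrA; congr (_ * _)%:E.
    by field; rewrite gt_eqF.
  rewrite ge0_integralZl//=.
  + rewrite phi_centered_moment -EFinM; congr EFin.
    by field; rewrite gt_eqF.
  + apply: (@measurable_polyphi (('X - ((c - m) / s)%:P) ^+ 2)) => x.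
    by rewrite !hornerE.
  + by move=> x _; rewrite lee_fin mulr_ge0 ?sqr_ge0 ?phi_ge0.
  + by rewrite lee_fin sqr_ge0.
- move=> x; apply: cvgM; last by apply: continuous_normal_pdf; rewrite gt_eqF.
  by apply: cvgM; apply: cvgB; [exact: cvg_id|exact: cvg_cst|exact: cvg_id|exact: cvg_cst].
- by move=> x; rewrite mulr_ge0 ?sqr_ge0 ?normal_pdf_ge0.
Qed.

End normal_density.

(** * The normal distribution function and its quantiles *)

Section normal_cdf.
Context {R : realType}.
Local Notation mu := (@lebesgue_measure R).
Local Notation phi := (@normal_pdf R 0 1).
Implicit Types m s x c b : R.

Lemma Phi_fin x : Phi x%:E = normal_prob (0:R) 1 `]-oo, x].
Proof.
congr normal_prob; apply/seteqP; split => z /=; rewrite in_itv/= ?lee_fin//.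
Qed.

Lemma Phi_y : Phi (+oo%E : \bar R) = 1%E.
Proof.
rewrite /Phi (_ : [set _ | _] = setT); first by rewrite probability_setT.
by apply/seteqP; split => z //= _; rewrite leey.
Qed.

Lemma normal_prob_itvNy m s b : 0 < s ->
  normal_prob m s `]-oo, b] = Phi ((b - m) / s)%:E.
Proof.
move=> s0; rewrite Phi_fin /normal_prob; set b' := (b - m) / s.
have F'E := derive1_affine m s.
have cF : continuous (fun x => s * x + m).
  move=> x; have := is_derive_affine m s x => d.
  exact/differentiable_continuous/derivable1_diffP/ex_derive.
have -> : b = (fun x => s * x + m) b' by rewrite /b'/=; field; rewrite gt_eqF.
rewrite (@increasing_ge0_integration_by_substitutionNy _ (fun x => s * x + m)).
- apply: eq_integral => x _; rewrite F'E/=; congr EFin.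
  by rewrite -(normal_pdf_affine m x s0).
- by move=> x y _ _ xy; rewrite ltrD2r ltr_pM2l.
- by rewrite F'E => ? _; exact: cvg_cst.
- by rewrite F'E; exact: is_cvg_cst.
- by rewrite F'E; exact: cvg_cst.
- split.
  + by move=> x _; have := is_derive_affine m s x => d; exact: ex_derive.
  + exact/cvg_at_left_filter/cF.
- by apply: cvg_comp (cvg_addrr_Ny m); exact: gt0_cvgMrNy.
- apply: continuous_subspaceT; apply: continuous_normal_pdf; by rewrite gt_eqF.
- by move=> x _; exact: normal_pdf_ge0.
Qed.

Lemma phi_le x y : x ^+ 2 <= y ^+ 2 -> phi y <= phi x.
Proof.
by move=> xy; rewrite phiE ler_wpM2l ?normal_peak_ge0// ler_expR ler_wnM2l// oppr_le0.
Qed.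

Lemma N01_itv_gt0 a b : a < b -> (0 < normal_prob (0:R) 1 `]a, b])%E.
Proof.
move=> ab; pose c := phi (`|a| + `|b|).
have c0 : 0 < c by rewrite normal_pdf_gt0 ?oner_eq0.
apply: (@lt_le_trans _ _ (\int[mu]_(x in `]a, b]) c%:E)%E).
  by rewrite integral_cst//= lebesgue_measure_itv/= lte_fin ab -EFinB -EFinM lte_fin
             mulr_gt0// subr_gt0.
apply: ge0_le_integral => //=.
- by move=> x _; rewrite lee_fin ltW.
- apply/measurable_EFinP; apply: measurable_funTS; exact: measurable_phi.
- move=> x; rewrite in_itv/= => /andP[/ltW ax xb]; rewrite lee_fin; apply: phi_le.
  rewrite -[x ^+ 2]real_normK ?num_real// ler_pXn2r ?nnegrE ?addr_ge0//.
  by rewrite ler_norml; have := ler_norm b; have := ler_norm (- a); rewrite normrN;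
    have := normr_ge0 a; have := normr_ge0 b; move=> *; apply/andP; split; lra.
Qed.

(** Strict up to [+oo], so that no real number is a quantile of level 1. *)
Lemma Phi_lt : {homo @Phi R : x y / (x < y)%E}.
Proof.
have ex (x y : \bar R) : (x < y)%E -> exists a b, [/\ a < b, (x <= a%:E)%E & (b%:E <= y)%E].
  case: x y => [x| |] [y| |]//=; rewrite ?lte_fin => xy.
  - by exists x, y.
  - by exists x, (x + 1); rewrite ltrDl ltr01 leey.
  - by exists (y - 1), y; rewrite ltrBlDr ltrDl ltr01 leNye.
  - by exists 0, 1; rewrite ltr01 leNye leey.
move=> x y /ex[a [b [ab xa by_]]].
have mE (z : \bar R) : measurable [set t : R | (t%:E <= z)%E].
  case: z => [z| |].
  - rewrite (_ : [set _ | _] = [set` `]-oo, z]]); first exact: measurable_itv.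
    by apply/seteqP; split => t /=; rewrite in_itv/= lee_fin.
  - by rewrite (_ : [set _ | _] = setT)//; apply/seteqP; split => t //= _; rewrite leey.
  - by rewrite (_ : [set _ | _] = set0)//; apply/seteqP; split => t.
apply: (@lt_le_trans _ _ (Phi x + normal_prob (0:R) 1 `]a, b])%E).
  rewrite lteDl ?N01_itv_gt0//; by apply: fin_num_measure; exact: mE.
rewrite -measureU//; [|exact: mE|]; last first.
  rewrite -subset0 => t [/= tx]; rewrite in_itv/= => /andP[at_ _].
  by move: (le_trans tx xa); rewrite lee_fin leNgt at_.
apply: le_measure; rewrite ?inE; [apply: measurableU => //; exact: mE|exact: mE|].
move=> t [/= tx|/=].
  by apply: (le_trans (le_trans tx xa)); apply: le_trans by_; rewrite lee_fin ltW.
by rewrite in_itv/= => /andP[_ tb]; apply: le_trans by_; rewrite lee_fin.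
Qed.

Lemma Phi_le : {mono @Phi R : x y / (x <= y)%E}.
Proof. exact: le_mono Phi_lt. Qed.

(** By symmetry; this bound is what makes the quantiles of level above 1/2
    nonnegative. *)
Lemma Phi0_half : (Phi (0%E : \bar R) <= (2^-1)%:E)%E.
Proof.
have sym : normal_prob (0:R) 1 `]-oo, 0] = normal_prob (0:R) 1 `[0, +oo[.
  have := @ge0_integration_by_substitutionNy R phi 0.
  rewrite oppr0 /normal_prob => h; transitivity (\int[mu]_(x in `[0%R, +oo[) (phi (- x))%:E)%E.
    apply: h; last by move=> x _; exact: phi_ge0.
    exact: (continuous_subspaceT (@continuous_phi R)).
  by apply: eq_integral => x _ /=; rewrite phi_sym.
have atom : normal_prob (0:R) 1 `[0, +oo[ = normal_prob (0:R) 1 `]0, +oo[.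
  rewrite /normal_prob integral_itv_obnd_cbnd//.
  by apply/measurable_EFinP/measurable_funTS; exact: measurable_phi.
have : (normal_prob (0:R) 1 `]-oo, 0%R] + normal_prob (0:R) 1 `]0%R, +oo[ = 1)%E.
  rewrite -measureU//; last first.
    rewrite -subset0 => t [] /=; rewrite !in_itv/= andbT => t0.
    by rewrite ltNge t0.
  rewrite (_ : _ `|` _ = setT); first exact: probability_setT.
  by apply/seteqP; split => t //= _; rewrite !in_itv/= andbT; case: leP; [left|right].
rewrite -atom -sym Phi_fin.
have : normal_prob (0:R) 1 `]-oo, 0] \is a fin_num by exact: fin_num_measure.
by move: (normal_prob _ _ _) => [r| |]// _ [] rr; rewrite lee_fin; lra.
Qed.

(* The identity as a random variable of standard normal law: its distribution
   function is [Phi], whose limits at infinity are then known. *)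
Let idN : measurableTypeR R -> R := idfun.
#[local] HB.instance Definition _ :=
  @isMeasurableFun.Build _ _ _ _ idN (@measurable_id _ _ setT).

Let cdfE x : cdf (idN : {RV (normal_prob (0:R) 1) >-> R}) x = Phi x%:E.
Proof. by rewrite Phi_fin. Qed.

Lemma Phi_gt_ex (p : R) : p < 1 -> exists x : R, (p%:E < Phi x%:E)%E.
Proof.
move=> p1.
have := cvg_cdfy1 (idN : {RV (normal_prob (0:R) 1) >-> R}).
move=> /fine_cvgP[_] /cvgr_gt /(_ p p1) h.
have [x px] := filter_ex h.
exists x; rewrite -cdfE.
have : cdf (idN : {RV (normal_prob (0:R) 1) >-> R}) x \is a fin_num by exact: fin_num_measure.
by move=> /fineK <-; rewrite lte_fin.
Qed.

Lemma Phi_lt_ex (p : R) : 0 < p -> exists x : R, (Phi x%:E < p%:E)%E.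
Proof.
move=> p0.
have := cvg_cdfNy0 (idN : {RV (normal_prob (0:R) 1) >-> R}).
move=> /fine_cvgP[_] /cvgr_lt /(_ p p0) h.
have [x px] := filter_ex h.
exists x; rewrite -cdfE.
have : cdf (idN : {RV (normal_prob (0:R) 1) >-> R}) x \is a fin_num by exact: fin_num_measure.
by move=> /fineK <-; rewrite lte_fin.
Qed.

Lemma Phi_increment a x : a <= x ->
  (Phi x%:E = Phi a%:E + (parameterized_integral mu a x phi)%:E)%E.
Proof.
move=> ax; rewrite !Phi_fin.
have -> : ((parameterized_integral mu a x phi)%:E = normal_prob (0:R) 1 `[a, x])%E.
  rewrite /parameterized_integral /Rintegral fineK//.
  by have : normal_prob (0:R) 1 `[a, x] \is a fin_num by exact: fin_num_measure.
have -> : normal_prob (0:R) 1 `[a, x] = normal_prob (0:R) 1 `]a, x].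
  rewrite /normal_prob integral_itv_obnd_cbnd//.
  by apply/measurable_EFinP; apply: measurable_funTS; exact: measurable_phi.
rewrite -measureU//.
  congr normal_prob; apply/seteqP; split => t /=; rewrite !in_itv/=.
    by move=> tx; case: leP => ta; [left|right].
  by move=> [ta|/andP[]//]; exact: le_trans ax.
rewrite -subset0 => t [] /=; rewrite !in_itv/= => ta.
by rewrite ltNge ta.
Qed.

(** The increments of [Phi] are continuous integrals, so the intermediate value
    theorem applies between two points given by the limits of [Phi]. *)
Lemma Phi_surj p : 0 < p < 1 -> exists x : R, Phi x%:E = p%:E.
Proof.
move=> /andP[/Phi_lt_ex[a ap] /Phi_gt_ex[b pb]].
have ab : a <= b.
  by have := lt_trans ap pb; rewrite (leW_mono Phi_le) lte_fin => /ltW.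
have Ffin x : Phi x%:E \is a fin_num by rewrite Phi_fin fin_num_measure.
have ip : mu.-integrable `[a, b] (EFin \o phi).
  apply: (@integrableS _ _ _ _ setT) => //; exact: integrable_normal_pdf.
have cF := parameterized_integral_continuous ab ip.
have [|c cab Fc] := IVT (v := p - fine (Phi a%:E)) ab cF.
  have := Phi_increment ab; have := Phi_increment (lexx a).
  rewrite -(fineK (Ffin a)) -(fineK (Ffin b)) -!EFinD => -[Fa] [Fb].
  move: ap pb; rewrite -(fineK (Ffin a)) -(fineK (Ffin b)) !lte_fin => ap pb.
  by rewrite ge_min le_max; apply/andP; split; apply/orP; [left|right]; lra.
exists c; move: cab; rewrite in_itv/= => /andP[ac _].
rewrite (Phi_increment ac) Fc -(fineK (Ffin a)) -EFinD; congr EFin => /=; lra.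
Qed.

Lemma Phi_invP (p : R) : 0 <= p < 2^-1 ->
  (0 <= Phi_inv (1 - p))%E /\ Phi (Phi_inv (1 - p)) = (1 - p)%:E.
Proof.
move=> /andP[p0 p2].
have [z Pz] : exists z : \bar R, Phi z = (1 - p)%:E.
  have [->|pN0] := eqVneq p 0; first by exists +oo%E; rewrite Phi_y subr0.
  have [|x ?] := @Phi_surj (1 - p); last by exists x%:E.
  by move: p0; rewrite le_eqVlt eq_sym (negPf pN0)/= => p0; apply/andP; split; lra.
have PI : Phi (Phi_inv (1 - p)) = (1 - p)%:E.
  by rewrite /Phi_inv; case: xgetP => // /(_ z).
split=> //; rewrite leNgt; apply/negP => /ltW; rewrite -Phi_le PI.
by move=> /le_trans/(_ Phi0_half); rewrite lee_fin; lra.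
Qed.

(** For [v] positive this is standardization.  For [v = 0] the product vanishes
    even if the quantile is [+oo], and the Dirac mass at [m] gives the event
    [m <= b] probability 0 or 1, while [1 - p] is positive. *)
Lemma gauss_chanceP (m v b p : R) : 0 <= v -> 0 <= p < 2^-1 ->
  ((1 - p)%:E <= gauss_law m v [set x | (x <= b)%R])%E <->
  (m%:E + (Num.sqrt v)%:E * Phi_inv (1 - p) - b%:E <= 0)%E.
Proof.
move=> v0 p2; have [z0 Pz] := Phi_invP p2.
set z := Phi_inv (1 - p) in z0 Pz *.
rewrite sube_le0 //.
have [->|vN0] := eqVneq v 0.
  rewrite /gauss_law eqxx sqrtr0 mul0e adde0 [\d_m _]diracE !lee_fin.
  have -> : (m \in [set x | x <= b]) = (m <= b) by apply/idP/idP; rewrite inE.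
  case/andP: p2 => p0 p1; split; last by move=> ->; rewrite mulr1n; lra.
  by apply: contraTT => /negPf->; rewrite -ltNge mulr0n; lra.
have s0 : 0 < Num.sqrt v by rewrite sqrtr_gt0 lt_neqAle eq_sym vN0.
rewrite /gauss_law (negPf vN0).
have -> : [set x | x <= b] = `]-oo, b]%classic by apply/seteqP; split.
rewrite normal_prob_itvNy// -Pz Phi_le.
case: z z0 {Pz} => [z| |]// _.
  by rewrite -EFinM -EFinD !lee_fin ler_pdivlMr// lerBrDl mulrC.
by rewrite gt0_muley ?lte_fin// addey.
Qed.

(** [normal_prob m 0] is the uniform law on [0, 1], not a Dirac mass, and
    does not depend on [m]. *)
Lemma gauss_law_neg (m v b : R) : v < 0 -> 0 <= b <= 1 ->
  gauss_law m v `]-oo, b]%classic = b%:E.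
Proof.
move=> v0 /andP[b0 b1]; rewrite /gauss_law lt_eqF// ltr0_sqrtr//.
rewrite /normal_prob /normal_pdf eqxx.
rewrite integral_indic// (_ : _ `&` _ = `[0, b]%classic).
  transitivity (mu `[0, b]%classic) => //.
  by rewrite lebesgue_measure_itv/= lte_fin oppr0 adde0; case: ltP => // ?;
     congr EFin; apply/eqP; rewrite eq_le b0.
apply/seteqP; split=> x /=; rewrite !in_itv/=; first by move=> [/andP[-> _] ->].
by move=> /andP[-> xb]; rewrite xb (le_trans xb).
Qed.

(** The density agrees almost everywhere with the Radon-Nikodym derivative, for
    which the change of measure is known. *)
Lemma integral_normal_prob m s (f : R -> R) : s != 0 -> measurable_fun setT f ->
  (forall x, 0 <= f x) ->
  (\int[normal_prob m s]_x (f x)%:E = \int[mu]_x (f x * normal_pdf m s x)%:E)%E.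
Proof.
move=> s0 mf f0.
have dom := normal_prob_dominates m s.
have mf' : measurable_fun setT (EFin \o f) by exact/measurable_EFinP.
rewrite -(Radon_Nikodym_SigmaFinite.change_of_variables dom)//.
apply: ae_eq_integral => //.
- apply: emeasurable_funM => //.
  apply: measurable_int (Radon_Nikodym_SigmaFinite.f_integrable dom).
- apply/measurable_EFinP; apply: measurable_funM => //; exact: measurable_normal_pdf.
under [X in ae_eq _ _ _ X]eq_fun do rewrite EFinM.
apply: ae_eqe_mul2l; apply: integral_ae_eq => //.
- exact: Radon_Nikodym_SigmaFinite.f_integrable.
- apply/measurable_EFinP; exact: measurable_normal_pdf.
- by move=> E _ mE; rewrite -Radon_Nikodym_SigmaFinite.f_integral.
Qed.

End normal_cdf.

Section gaussian_moments.
Context d (Omega : measurableType d) (R : realType) (P : probability Omega R).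

Lemma ge0_integral_law d' (T : measurableType d') (nu : {measure set T -> \bar R})
    (X : Omega -> T) (f : T -> \bar R) :
  measurable_fun setT X -> measurable_fun setT f -> (forall x, 0 <= f x)%E ->
  (forall C, measurable C -> P (X @^-1` C) = nu C) ->
  (\int[P]_o f (X o) = \int[nu]_x f x)%E.
Proof.
move=> mX mf f0 lawX; pose XRV : {mfun Omega >-> T} := mfun_Sub (mem_set mX).
rewrite -[LHS](ge0_integral_distribution (XRV : {RV P >-> T}) mf)//.
by apply: eq_measure_integral => A mA _; exact: lawX.
Qed.

Lemma gauss_law_moment (X : Omega -> R) (m v c : R) : measurable_fun setT X ->
  0 <= v ->
  (forall C, measurable C -> P (X @^-1` C) = gauss_law m v C) ->
  (\int[P]_o ((X o - c) ^+ 2)%:E = ((m - c) ^+ 2 + v)%:E)%E.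
Proof.
move=> mX v0 lawX.
have mf : measurable_fun setT (fun x : R => ((x - c) ^+ 2)%:E).
  by apply/measurable_EFinP; apply: measurable_funX; apply: measurable_funB.
have f0 (x : R) : (0 <= ((x - c) ^+ 2)%:E)%E by rewrite lee_fin sqr_ge0.
have [vE|vN0] := eqVneq v 0.
  rewrite (ge0_integral_law (nu := dirac m) mX mf f0); last first.
    by move=> A mA; rewrite lawX// /gauss_law vE eqxx.
  by rewrite integral_dirac// diracT mul1e vE addr0.
have s0 : 0 < Num.sqrt v by rewrite sqrtr_gt0 lt_neqAle eq_sym vN0.
rewrite (ge0_integral_law (nu := normal_prob m (Num.sqrt v)) mX mf f0); last first.
  by move=> A mA; rewrite lawX// /gauss_law (negPf vN0).
rewrite integral_normal_prob ?gt_eqF//.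
- by rewrite normal_centered_moment// sqr_sqrtr.
by apply: measurable_funX; apply: measurable_funB.
Qed.

End gaussian_moments.

(** * First and second moments of random vectors *)

Section expectation_lincomb.
Context d (Omega : measurableType d) (R : realType) (P : probability Omega R).

Lemma Lfun_lincomb (p : R) (I : Type) (s : seq I) (c : I -> R) (f : I -> Omega -> R) :
  1 <= p -> (forall i, f i \in Lfun P p%:E) ->
  (fun o => \sum_(i <- s) c i * f i o) \in Lfun P p%:E.
Proof.
move=> p1 fL; elim: s => [|i s IH].
  by under eq_fun do rewrite big_nil; exact: Lfun_cst.
under eq_fun do rewrite big_cons mulrC.
have p1' : (1 <= p%:E)%E by rewrite lee_fin.
have [_] := @Lfun_addr_closed _ _ _ P _ p1'.
by apply => //; apply: Lfun_scale.
Qed.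

Lemma expectation_lincomb (I : Type) (s : seq I) (c : I -> R) (f : I -> Omega -> R) :
  (forall i, f i \in Lfun P 1%:E) ->
  ('E_P[fun o => (\sum_(i <- s) c i * f i o)%R] =
   (\sum_(i <- s) c i * fine 'E_P[f i])%R%:E)%E.
Proof.
move=> fL; elim: s => [|i s IH].
  by under eq_fun do rewrite big_nil; rewrite big_nil expectation_cst.
under eq_fun do rewrite big_cons mulrC.
rewrite (@expectationD _ _ _ P (c i \o* f i) (fun o => \sum_(j <- s) c j * f j o)).
- rewrite IH expectationZl// big_cons EFinD EFinM fineK//.
  exact: expectation_fin_num.
- exact: Lfun_scale.
- exact: Lfun_lincomb.
Qed.

Lemma Lfun2_1 (f : Omega -> R) : f \in Lfun P 2%:E -> f \in Lfun P 1%:E.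
Proof. by apply: Lfun_subset12; rewrite fin_num_measure. Qed.

End expectation_lincomb.

Section random_vector_moments.
Context d (Omega : measurableType d) (R : realType) (P : probability Omega R).

Lemma sqint_affine m n (A : 'M[R]_(m, n)) b (X : Omega -> 'cV[R]_n) :
  square_integrable P X -> square_integrable P (fun o => A *m X o + b).
Proof.
move=> XL i; under eq_fun do rewrite !mxE.
have [_] := @Lfun_addr_closed _ _ _ P 2%:E (lee1n 2).
apply; last exact: Lfun_cst.
by apply: Lfun_lincomb => //; rewrite ler1n.
Qed.

Lemma sqint_mul m n (A : 'M[R]_(m, n)) (X : Omega -> 'cV[R]_n) :
  square_integrable P X -> square_integrable P (fun o => A *m X o).
Proof. by move=> /(sqint_affine A 0); under eq_fun do rewrite addr0. Qed.

Lemma sqint_cst n (b : 'cV[R]_n) : square_integrable P (fun=> b).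
Proof. by move=> i; exact: Lfun_cst. Qed.

Lemma sqintD n (X Y : Omega -> 'cV[R]_n) :
  square_integrable P X -> square_integrable P Y ->
  square_integrable P (fun o => X o + Y o).
Proof.
move=> XL YL i; under eq_fun do rewrite !mxE.
by have [_] := @Lfun_addr_closed _ _ _ P 2%:E (lee1n 2); apply.
Qed.

Lemma mean_affine m n (A : 'M[R]_(m, n)) b (X : Omega -> 'cV[R]_n) :
  square_integrable P X -> mean P (fun o => A *m X o + b) = A *m mean P X + b.
Proof.
move=> XL; apply/matrixP => i j; rewrite !mxE ord1.
have XL1 k : (fun o => X o k 0) \in Lfun P 1%:E by exact: Lfun2_1.
under eq_fun do rewrite !mxE.
rewrite (@expectationD _ _ _ P (fun o => \sum_j A i j * X o j 0) (cst (b i 0))).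
- rewrite expectation_lincomb// expectation_cst -EFinD/=; congr (_ + _).
  by apply: eq_bigr => k _; rewrite mxE.
- exact: Lfun_lincomb.
- exact: Lfun_cst.
Qed.

Lemma meanD n (X Y : Omega -> 'cV[R]_n) :
  square_integrable P X -> square_integrable P Y ->
  mean P (fun o => X o + Y o) = mean P X + mean P Y.
Proof.
move=> XL YL; apply/matrixP => i j; rewrite !mxE.
under eq_fun do rewrite mxE.
rewrite (@expectationD _ _ _ P (fun o => X o i 0) (fun o => Y o i 0)) ?Lfun2_1//.
by rewrite fineD// expectation_fin_num// Lfun2_1.
Qed.

Lemma cross_moment_mul m n p q (A : 'M[R]_(m, n)) (B : 'M[R]_(p, q))
    (X : Omega -> 'cV[R]_n) (Y : Omega -> 'cV[R]_q) :
  square_integrable P X -> square_integrable P Y ->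
  cross_moment P (fun o => A *m X o) (fun o => B *m Y o) =
  A *m cross_moment P X Y *m B^T.
Proof.
move=> XL YL; apply/matrixP => i j; rewrite mxE.
rewrite (_ : (fun o => _) = (fun o => \sum_(k : 'I_n * 'I_q)
           (A i k.1 * B j k.2) * (X o k.1 0 * Y o k.2 0))); last first.
  apply/funext => o; rewrite !mxE mulr_suml.
  under eq_bigr do rewrite mulr_sumr.
  by rewrite pair_big; apply: eq_bigr => -[k l] _ /=; ring.
rewrite expectation_lincomb; last by move=> [k l]; exact: Lfun2_mul_Lfun1.
rewrite /= mxE -(pair_bigA _ (fun k l => A i k * B j l *
  fine 'E_P[fun o => (X o k 0 * Y o l 0)%R])).
rewrite exchange_big; apply: eq_bigr => l _; rewrite !mxE mulr_suml.
by apply: eq_bigr => k _; rewrite !mxE; ring.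
Qed.

Lemma cross_momentDl m n (X X' : Omega -> 'cV[R]_m) (Y : Omega -> 'cV[R]_n) :
  square_integrable P X -> square_integrable P X' -> square_integrable P Y ->
  cross_moment P (fun o => X o + X' o) Y = cross_moment P X Y + cross_moment P X' Y.
Proof.
move=> XL X'L YL; apply/matrixP => i j; rewrite !mxE.
under eq_fun do rewrite mxE mulrDl.
have L1 := Lfun2_mul_Lfun1 (XL i) (YL j).
have L2 := Lfun2_mul_Lfun1 (X'L i) (YL j).
rewrite (@expectationD _ _ _ P (fun o => X o i 0 * Y o j 0) (fun o => X' o i 0 * Y o j 0))//.
by rewrite fineD// expectation_fin_num.
Qed.

Lemma tr_cross_moment m n (X : Omega -> 'cV[R]_m) (Y : Omega -> 'cV[R]_n) :
  (cross_moment P X Y)^T = cross_moment P Y X.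
Proof. by apply/matrixP => i j; rewrite !mxE; under eq_fun do rewrite mulrC. Qed.

Lemma cross_momentDr m n (X : Omega -> 'cV[R]_m) (Y Y' : Omega -> 'cV[R]_n) :
  square_integrable P X -> square_integrable P Y -> square_integrable P Y' ->
  cross_moment P X (fun o => Y o + Y' o) = cross_moment P X Y + cross_moment P X Y'.
Proof.
move=> XL YL Y'L; rewrite -tr_cross_moment cross_momentDl// linearD/=.
by rewrite !tr_cross_moment.
Qed.

Lemma cross_moment_cstl m n (b : 'cV[R]_m) (Y : Omega -> 'cV[R]_n) :
  square_integrable P Y -> cross_moment P (fun=> b) Y = b *m (mean P Y)^T.
Proof.
move=> YL; apply/matrixP => i j; rewrite !mxE big_ord1 !mxE.
rewrite (_ : (fun o => _) = (fun o => \sum_(k <- [:: tt]) b i 0 * Y o j 0)).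
  rewrite (expectation_lincomb _ _ (f := fun _ o => Y o j 0)) ?big_seq1//.
  by move=> _; exact: Lfun2_1.
by apply/funext => o; rewrite big_seq1.
Qed.

Lemma cov_mx_affine m n (A : 'M[R]_(m, n)) b (X : Omega -> 'cV[R]_n) :
  square_integrable P X ->
  cov_mx P (fun o => A *m X o + b) = A *m cov_mx P X *m A^T.
Proof.
move=> XL; rewrite /cov_mx mean_affine// -cross_moment_mul; first last.
- exact: (sqintD XL (sqint_cst (- mean P X))).
- exact: (sqintD XL (sqint_cst (- mean P X))).
by congr cross_moment; apply/funext => o; rewrite mulmxBr opprD addrACA subrr addr0.
Qed.

Lemma tr_cov_mx n (X : Omega -> 'cV[R]_n) : (cov_mx P X)^T = cov_mx P X.
Proof. exact: tr_cross_moment. Qed.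

Lemma cross_moment_cov n (X : Omega -> 'cV[R]_n) : square_integrable P X ->
  cross_moment P X X = cov_mx P X + mean P X *m (mean P X)^T.
Proof.
move=> XL; rewrite /cov_mx; set m := mean P X.
have mL := sqint_cst m; have mcst : mean P (fun=> m) = m.
  by apply/matrixP => i j; rewrite mxE expectation_cst ord1.
pose Xc o := X o - m.
have XcL : square_integrable P Xc by exact: (sqintD XL (sqint_cst _)).
have Xc0 : mean P Xc = 0.
  rewrite (meanD XL (sqint_cst _)); apply/matrixP => i j.
  by rewrite ord1 !mxE expectation_cst/= subrr.
have XE : X = (fun o => Xc o + m) by apply/funext => o; rewrite /Xc subrK.
rewrite -/Xc [in LHS]XE; clearbody Xc.
rewrite cross_momentDl; [|exact: XcL|exact: mL|exact: (sqintD XcL mL)].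
rewrite !cross_momentDr// -[cross_moment P Xc (fun=> m)]tr_cross_moment.
by rewrite !cross_moment_cstl// Xc0 mcst !trmx0 mulmx0 trmx0 addr0 add0r.
Qed.

Lemma qform_Lfun n (M : 'M[R]_n) (X : Omega -> 'cV[R]_n) : square_integrable P X ->
  (fun o => qform M (X o)) \in Lfun P 1%:E /\
  ('E_P[fun o => qform M (X o)] =
    (qform M (mean P X) + \tr (M *m cov_mx P X))%:E)%E.
Proof.
move=> XL.
have E : (fun o => qform M (X o)) = (fun o => \sum_(k : 'I_n * 'I_n)
           M k.1 k.2 * (X o k.1 0 * X o k.2 0)).
  apply/funext => o; rewrite /qform !mxE.
  under eq_bigr do rewrite !mxE mulr_suml.
  rewrite exchange_big pair_big/=; apply: eq_bigr => -[k l] _ /=; rewrite !mxE; ring.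
have L1 (k : 'I_n * 'I_n) : (fun o => X o k.1 0 * X o k.2 0) \in Lfun P 1%:E.
  exact: Lfun2_mul_Lfun1.
split; first by rewrite E; exact: Lfun_lincomb.
rewrite E expectation_lincomb//; congr EFin.
transitivity (\tr (M *m cross_moment P X X)).
  rewrite -(pair_bigA _ (fun k l => M k l * fine 'E_P[fun o => (X o k 0 * X o l 0)%R]))/=.
  apply: eq_bigr => k _; rewrite mxE; apply: eq_bigr => l _.
  by rewrite -tr_cross_moment !mxE.
rewrite cross_moment_cov// mulmxDr mxtraceD addrC; congr (_ + _).
by rewrite mulmxA mxtrace_mulC mulmxA /qform trace_mx11.
Qed.

End random_vector_moments.

(** * Gaussian vectors *)

Section gaussian_vectors.
Context d (Omega : measurableType d) (R : realType) (P : probability Omega R).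

Lemma measurable_dot n (a : 'cV[R]_n) (X : Omega -> 'cV[R]_n) :
  random_vector X -> measurable_fun setT (fun o => dot a (X o)).
Proof.
move=> mX; under eq_fun do rewrite dotE.
by apply: measurable_sum => i; apply: measurable_funM.
Qed.

Lemma dotZl n (c : R) (a v : 'cV[R]_n) : dot (c *: a) v = c * dot a v.
Proof. by rewrite !dotE mulr_sumr; apply: eq_bigr => i _; rewrite mxE mulrA. Qed.

(** Where the form of [S] is negative, [gauss_law] is uniform on [0, 1], so both
    [a^T X] and [2 a^T X] would be uniform on [0, 1]. *)
Lemma gaussian_form_ge0 n (X : Omega -> 'cV[R]_n) m S a :
  gaussian_vector P X m S -> 0 <= qform S a.
Proof.
move=> [_ lawX]; rewrite leNgt; apply/negP => q0.
have q20 : qform S (2 *: a) < 0 by rewrite qform_scale pmulr_rlt0// exprn_gt0.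
have h1 := lawX a `]-oo, 2^-1]%classic (measurable_itv _).
have h2 := lawX (2 *: a) `]-oo, 1]%classic (measurable_itv _).
rewrite gauss_law_neg// in h1; last by apply/andP; split; lra.
rewrite gauss_law_neg// in h2; last by rewrite ler01 lexx.
have : (1%:E = (2^-1)%:E :> \bar R).
  rewrite -h1 -h2; congr (P _); apply/seteqP; split => o /=; rewrite !in_itv/= dotZl; lra.
by move=> [] ; lra.
Qed.

Lemma Lfun2_of_moment (Y : Omega -> R) (v : R) : measurable_fun setT Y ->
  (\int[P]_o (Y o ^+ 2)%:E = v%:E)%E -> Y \in Lfun P 2%:E.
Proof.
move=> mY IY; rewrite inE; apply/andP; split; rewrite inE//=.
rewrite /finite_norm unlock /Lnorm poweR_lty//.
by under eq_integral do rewrite /= powR_mulrn// real_normK ?num_real//; rewrite IY ltry.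
Qed.

Section gaussian.
Context n (X : Omega -> 'cV[R]_n) (m : 'cV[R]_n) (S : 'M[R]_n).
Hypothesis GX : gaussian_vector P X m S.

Let moment a c : (\int[P]_o ((dot a (X o) - c) ^+ 2)%:E =
   ((dot a m - c) ^+ 2 + qform S a)%:E)%E.
Proof.
have [mX lawX] := GX.
apply: gauss_law_moment; [exact: measurable_dot|exact: gaussian_form_ge0 GX|].
by move=> C mC; exact: lawX.
Qed.

Let dotL a : (fun o => dot a (X o)) \in Lfun P 2%:E.
Proof.
apply: (@Lfun2_of_moment _ ((dot a m - 0) ^+ 2 + qform S a)).
  by case: GX => mX _; exact: measurable_dot.
by rewrite -(moment a 0); apply: eq_integral => o _; rewrite subr0.
Qed.

Lemma dot_delta (i : 'I_n) (v : 'cV[R]_n) : dot (delta_mx i 0) v = v i 0.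
Proof.
rewrite dotE (bigD1 i)//= big1 ?addr0 => [|j ji]; rewrite mxE ?eqxx ?mul1r//.
by rewrite (negPf ji) mul0r.
Qed.

Lemma gaussian_sqint : square_integrable P X.
Proof.
by move=> i; have := dotL (delta_mx i 0); under eq_fun do rewrite dot_delta.
Qed.

(* Both sides are the second moment of [a^T X - c]: one from the first two moments
   of [X], the other from its law. *)
Let moment_match a c :
  (dot a (mean P X) - c) ^+ 2 + qform (cov_mx P X) a = (dot a m - c) ^+ 2 + qform S a.
Proof.
have YE v : qform 1%:M (a^T *m v + (- c)%:M) = (dot a v - c) ^+ 2.
  by rewrite qform1 dotvv big_ord1 mxE; congr ((_ + _) ^+ 2); rewrite mxE eqxx mulr1n.
have XL := gaussian_sqint.
have [_] := qform_Lfun 1%:M (sqint_affine a^T (- c)%:M XL).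
rewrite mean_affine// cov_mx_affine// trmxK mul1mx trace_mx11 YE unlock.
by under eq_integral do rewrite YE; rewrite moment => -[->].
Qed.

Lemma gaussian_mean : mean P X = m.
Proof.
apply/matrixP => i j; rewrite ord1 -!dot_delta.
have := moment_match (delta_mx i 0) 0; have := moment_match (delta_mx i 0) 1; nra.
Qed.

Lemma gaussian_cov a : qform (cov_mx P X) a = qform S a.
Proof. by have := moment_match a 0; rewrite gaussian_mean => /addrI. Qed.

(** A chance constraint on an affine image of a Gaussian vector only sees the
    first two moments of the image. *)
Lemma gaussian_chanceP k (L : 'M[R]_(k, n)) (l a : 'cV[R]_k) (b p : R) :
  let x o := L *m X o + l in
  0 <= p < 2^-1 ->
  ((1 - p)%:E <= P [set o | (dot a (x o) <= b)%R])%E <->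
  ((dot a (mean P x))%:E + (Num.sqrt (qform (cov_mx P x) a))%:E * Phi_inv (1 - p)
    - b%:E <= 0)%E.
Proof.
move=> x p2; have XL := gaussian_sqint.
rewrite /x mean_affine// cov_mx_affine// gaussian_mean.
have dotx v : dot a (L *m v + l) = dot (L^T *m a) v + dot a l.
  by rewrite /dot mulmxDr mxE trmx_mul trmxK mulmxA.
have -> : qform (L *m cov_mx P X *m L^T) a = qform S (L^T *m a).
  by rewrite -gaussian_cov qform_mulmx trmxK.
have -> : [set o | dot a (L *m X o + l) <= b] =
    (fun o => dot (L^T *m a) (X o)) @^-1` [set y | y <= b - dot a l].
  by apply/seteqP; split => o /=; rewrite dotx lerBrDr.
have [_ ->] := GX; last first.
  by rewrite (_ : [set y | _] = `]-oo, b - dot a l]%classic).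
rewrite gauss_chanceP//; last exact: gaussian_form_ge0 GX.
rewrite dotx; set q := (_ * _)%E.
rewrite !sube_le0// EFinB EFinD.
by rewrite leeBrDr// addeAC.
Qed.

End gaussian.
End gaussian_vectors.

(** * Stacked linear dynamics *)

Section stacked_dynamics.
Context (R : realType).

Lemma block_sel_mul m n p (s : 'I_m) (M : 'M[R]_(stk m n, p)) :
  block_sel R n s *m M = submxcol M s.
Proof.
rewrite -[M in LHS]submxcolK mul_mxrow_mxcol (bigD1 s)//= eqxx mul1mx big1 ?addr0//.
by move=> j /negPf->; rewrite mul0mx.
Qed.

Lemma block_sel_mxcol m n p (s : 'I_m) (C : 'I_m -> 'M[R]_(n, p)) :
  block_sel R n s *m \mxcol_(i < m) (C i) = C s.
Proof. by rewrite block_sel_mul mxcolK. Qed.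

Lemma mxcol_block_sel m n p (M : 'M[R]_(stk m n, p)) :
  \mxcol_(s < m) (block_sel R n s *m M) = M.
Proof.
rewrite -[RHS]submxcolK; apply: eq_mxcol => s; exact: block_sel_mul.
Qed.

Context (nx nu nw N Ns Nc : nat) (q : ocp_data R nx nu nw N Ns Nc).

Lemma Esel_calA s : Esel R nx s *m calA q = dA q ^+ s.
Proof. exact: block_sel_mxcol. Qed.

Lemma Esel_toeplitz m (M : 'M[R]_(nx, m)) (U : 'I_N -> 'cV[R]_m) (s : 'I_N.+1) :
  Esel R nx s *m (lower_toeplitz q M *m \mxcol_(j < N) (U j)) =
  \sum_(j < N) (if (j < s)%N then dA q ^+ (s - 1 - j) *m M else 0) *m U j.
Proof.
by rewrite mulmxA /lower_toeplitz mxblockEv block_sel_mxcol mul_mxrow_mxcol.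
Qed.

(** Variation of constants: row [s] of [calA] and of the block Toeplitz matrix
    are the solution operators of the recursion at time [s]. *)
Lemma linear_recursion m (M : 'M[R]_(nx, m)) (U : 'I_N -> 'cV[R]_m)
    (f : nat -> 'cV[R]_nx) :
  (forall s : 'I_N, f s.+1 = dA q *m f s + M *m U s) ->
  forall s : 'I_N.+1,
  f s = Esel R nx s *m (calA q *m f 0%N + lower_toeplitz q M *m \mxcol_(j < N) (U j)).
Proof.
move=> fS [s sN]; rewrite mulmxDr mulmxA Esel_calA Esel_toeplitz /=.
elim: s sN => [|s IH] sN.
  by rewrite expr0 mul1mx big1 ?addr0// => j _; rewrite mul0mx.
rewrite (fS (Ordinal (sN : (s < N)%N))) /= IH; last exact: ltnW.
rewrite mulmxDr mulmxA -[dA q *m dA q ^+ s]exprS -addrA; congr (_ + _).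
rewrite mulmx_sumr; set s0 := Ordinal _.
rewrite [in LHS](bigD1 s0)//= [in RHS](bigD1 s0)//= ltnn ltnSn.
rewrite mul0mx mulmx0 add0r subSS subn0 subnn expr0 mul1mx addrC; congr (_ + _).
apply: eq_bigr => j jNs.
have {}jNs : (j != s :> nat) by [].
rewrite ltnS [in RHS]leq_eqVlt (negPf jNs)/=; case: ifP => js; last by rewrite !mul0mx mulmx0.
rewrite !mulmxA -[dA q *m _ ^+ _]exprS; congr (_ ^+ _ *m _ *m _).
by rewrite -subnDA add1n subnSK.
Qed.

Lemma Kmat_mul (z : decision R nx nu N) (Y : 'cV[R]_(stk N.+1 nx)) :
  Kmat z *m Y = \mxcol_(s < N) (z.2 s *m (block_sel R nx (widen_ord (leqnSn N) s) *m Y)).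
Proof.
rewrite /Kmat mxblockEv mxcol_mul; apply: eq_mxcol => s.
rewrite -[Y in LHS]submxcolK mul_mxrow_mxcol (bigD1 (widen_ord (leqnSn N) s))//= eqxx.
rewrite block_sel_mul big1 ?addr0// => j js.
rewrite ifF ?mul0mx//; apply/negbTE; apply: contra js => /eqP sj.
by apply/eqP/val_inj.
Qed.

(** [y] solves a recursion driven by the noise alone, and [x - y] one driven by
    the input alone, with initial value [muk q].  The feedback acts through [y],
    so no fixed point has to be solved for. *)
Lemma closed_loop (z : decision R nx nu N) (x : nat -> 'cV[R]_nx)
    (u : nat -> 'cV[R]_nu) (y : nat -> 'cV[R]_nx) (w : nat -> 'cV[R]_nw) :
  y 0%N = x 0%N - muk q ->
  (forall s : 'I_N, y s.+1 = dA q *m y s + dD q *m w s) ->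
  (forall s : 'I_N, u s = z.1 s + z.2 s *m y s) ->
  (forall s : 'I_N, x s.+1 = dA q *m x s + dB q *m u s + dD q *m w s) ->
  let Y := calA q *m (x 0%N - muk q) + calD q *m \mxcol_(s < N) (w s) in
  (forall s : 'I_N.+1, x s = Esel R nx s *m IBK q z *m Y + Esel R nx s *m mean_traj q z) /\
  (forall s : 'I_N, u s = Fsel R nu s *m Kmat z *m Y + Fsel R nu s *m Vvec z).
Proof.
move=> y0 yS uE xS Y.
have yE s : y (nat_of_ord s) = Esel R nx s *m Y.
  by rewrite /Y -y0; apply: (linear_recursion (U := fun j => w j)).
have UE : \mxcol_(j < N) (u j) = Vvec z + Kmat z *m Y.
  rewrite Kmat_mul /Vvec -mxcolD; apply: eq_mxcol => s.
  by rewrite uE -[block_sel _ _ _ *m Y]yE.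
split=> s; last by rewrite -mulmxA -mulmxDr addrC -UE /Fsel block_sel_mxcol.
have gE : x s - y s = Esel R nx s *m (calA q *m muk q + calB q *m \mxcol_(j < N) (u j)).
  have -> : muk q = x 0%N - y 0%N by rewrite y0 opprB addrC subrK.
  apply: (@linear_recursion _ (dB q) (fun j => u j) (fun s => x s - y s)) => t.
  by rewrite xS yS mulmxBr opprD addrACA addrAC subrr addr0 addrAC.
rewrite -[LHS](subrK (y s)) gE yE UE -mulmxA -!mulmxDr; congr (_ *m _).
rewrite /IBK /mean_traj mulmxDr mulmxDl mul1mx mulmxA.
by rewrite addrA [RHS]addrC -!addrA; do 2!congr (_ + _); rewrite addrC addrA.
Qed.

End stacked_dynamics.

(** * Statistics of the closed loop *)

Section block_diagonal.
Context (R : realType).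

Lemma sum_block_sel m n :
  \sum_(s < m) (block_sel R n s)^T *m block_sel R n s = 1%:M.
Proof.
have colE : \mxcol_(s < m) block_sel R n s = 1%:M.
  by rewrite -[RHS]mxcol_block_sel; apply: eq_mxcol => s; rewrite mulmx1.
rewrite -mul_mxrow_mxcol colE mulmx1 -[RHS]trmx1 -colE tr_mxcol.
by [].
Qed.

(** Turns the block-diagonal weights of the program into sums over time of stage
    weights pulled back along the block selections. *)
Lemma mxdiag_sum_sel m n (B : 'I_m -> 'M[R]_n) :
  \mxdiag_(s < m) B s = \sum_(s < m) (block_sel R n s)^T *m B s *m block_sel R n s.
Proof.
rewrite -[LHS]mul1mx -sum_block_sel mulmx_suml; apply: eq_bigr => s _.
rewrite -!mulmxA; congr (_ *m _).
rewrite mul_mxrow_mxdiag mul_mxrow; apply: eq_mxrow => j.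
by case: eqP => [->|_]; rewrite ?mul1mx ?mulmx1 ?mul0mx ?mulmx0.
Qed.

End block_diagonal.

Section closed_loop_statistics.
Context d (Omega : measurableType d) (R : realType) (P : probability Omega R).
Context (nx nu nw N Ns Nc : nat) (q : ocp_data R nx nu nw N Ns Nc).
Context (k : nat) (xk : Omega -> 'cV[R]_nx) (w : nat -> Omega -> 'cV[R]_nw).
Hypothesis Hq : standing_assumptions q.
Hypothesis Hxk : gaussian_vector P xk (muk q) (Sigmak q).
Hypothesis Hw : gaussian_white_noise P k w.
Hypothesis Hxw : forall t, (k <= t)%N -> cross_moment P xk (w t) = 0.
Hypothesis Hjoint : exists m S, gaussian_vector P
       (fun o => col_mx (xk o) (\mxcol_(s < N) w (k + s)%N o)) m S.

Let W o : 'cV[R]_(stk N nw) := \mxcol_(s < N) w (k + s)%N o.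
Let Z o := col_mx (xk o) (W o).
(** The stacked response [y] of the control law: the only random quantity on
    which states and inputs depend. *)
Definition Yvec o := calA q *m (xk o - muk q) + calD q *m (\mxcol_(s < N) w (k + s)%N o).

Let xkL : square_integrable P xk. Proof. exact: gaussian_sqint Hxk. Qed.

Let wL t : (k <= t)%N -> square_integrable P (w t).
Proof. by move=> kt; exact: gaussian_sqint (noise_gaussian Hw kt). Qed.

Let WL : square_integrable P W.
Proof.
move=> i; have := wL (leq_addr (tagnat.sig1 i) k) (tagnat.sig2 i).
by congr (_ \in Lfun P _); apply/funext => o; rewrite mxE.
Qed.

Let W0 : mean P W = 0.
Proof.
apply/matrixP => i j; rewrite !mxE.
have := gaussian_mean (noise_gaussian Hw (leq_addr (tagnat.sig1 i) k)).
move=> /matrixP/(_ (tagnat.sig2 i) 0); rewrite !mxE => <-.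
by congr (fine (expectation P _)); apply/funext => o; rewrite mxE.
Qed.

Let WW : cross_moment P W W = 1%:M.
Proof.
transitivity (\mxblock_(s < N, t < N) cross_moment P (w (k + s)%N) (w (k + t)%N)).
  apply/matrixP => i j; rewrite !mxE.
  by congr (fine (expectation P _)); apply/funext => o; rewrite !mxE.
rewrite -mxdiagZ; apply: eq_mxblock => s t.
rewrite (noise_white Hw) ?leq_addr// eqn_add2l.
case: (eqVneq s t) => [->|st]; first by rewrite eqxx conform_mx_id.
rewrite (_ : (s == t :> nat) = false)//; last by apply/negbTE.
by rewrite raddf0.
Qed.

Let xc o := xk o - muk q.

Let xcL : square_integrable P xc.
Proof. exact: (sqintD xkL (sqint_cst _ _)). Qed.

Let xc0 : mean P xc = 0.
Proof.
rewrite (meanD xkL (sqint_cst _ _)) (gaussian_mean Hxk); apply/matrixP => i j.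
by rewrite ord1 !mxE expectation_cst/= subrr.
Qed.

(* [Sigmak q] is only known as the form giving the variances of the linear
   functionals of [xk]; both matrices being symmetric, they agree. *)
Let xcxc : cross_moment P xc xc = Sigmak q.
Proof.
have := sym_qform_inj (M2 := Sigmak q) (tr_cov_mx P xk).
rewrite /cov_mx (gaussian_mean Hxk); apply; first by case: (Sigmak_psd Hq).
by move=> a; rewrite -(gaussian_cov Hxk) /cov_mx (gaussian_mean Hxk).
Qed.

Let xcW : cross_moment P xc W = 0.
Proof.
rewrite cross_momentDl//; last exact: sqint_cst.
rewrite cross_moment_cstl// W0 trmx0 mulmx0 addr0.
transitivity (\mxrow_(s < N) cross_moment P xk (w (k + s)%N)).
  apply/matrixP => i j; rewrite !mxE.
  by congr (fine (expectation P _)); apply/funext => o; rewrite !mxE.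
by rewrite -mxrow0; apply: eq_mxrow => s; rewrite Hxw// leq_addr.
Qed.

Lemma Yvec_sqint : square_integrable P Yvec.
Proof. exact: sqintD (sqint_mul _ xcL) (sqint_mul _ WL). Qed.

Lemma Yvec_mean : mean P Yvec = 0.
Proof.
rewrite (meanD (sqint_mul _ xcL) (sqint_mul _ WL)).
have mul0 m n (A : 'M[R]_(m, n)) X : square_integrable P X -> mean P X = 0 ->
    mean P (fun o => A *m X o) = 0.
  move=> XL X0; have := mean_affine A 0 XL; rewrite X0 mulmx0 addr0 => <-.
  by congr mean; apply/funext => o; rewrite addr0.
by rewrite (mul0 _ _ _ _ xcL xc0) (mul0 _ _ _ _ WL W0) addr0.
Qed.

Lemma Yvec_cov : cov_mx P Yvec = Sigmay q.
Proof.
have := cross_moment_cov Yvec_sqint; rewrite Yvec_mean mul0mx addr0 => <-.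
have AL := sqint_mul (calA q) xcL; have DL := sqint_mul (calD q) WL.
rewrite /Yvec cross_momentDl; [|exact: AL|exact: DL|exact: sqintD].
rewrite !cross_momentDr; [|exact: DL|exact: AL|exact: DL|exact: AL|exact: AL|exact: DL].
rewrite !cross_moment_mul// -[cross_moment P W xc]tr_cross_moment.
by rewrite xcW trmx0 !mulmx0 !mul0mx xcxc WW mulmx1 addr0 add0r.
Qed.

Lemma Sigmay_psd : psd (Sigmay q).
Proof.
have [ST S0] := Sigmak_psd Hq.
apply: psdD; first by rewrite -[X in X *m _ *m _]trmxK; exact/psd_congr/Sigmak_psd.
by rewrite -[X in X *m _]trmxK -[X in X *m _]mulmx1; exact/psd_congr/psd1.
Qed.

(** The joint law of [xk] and the noises is what makes [G Yvec + g] Gaussian. *)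
Lemma Yvec_chanceP n (G : 'M[R]_(n, stk N.+1 nx)) (g a : 'cV[R]_n) (b p : R) :
  0 <= p < 2^-1 ->
  ((1 - p)%:E <= P [set o | (dot a (G *m Yvec o + g) <= b)%R])%E <->
  ((dot a g)%:E + (enorm (psd_sqrt (Sigmay q) *m G^T *m a))%:E * Phi_inv (1 - p)
    - b%:E <= 0)%E.
Proof.
move=> p2; have [m [S GZ]] := Hjoint.
have XE : (fun o => G *m Yvec o + g) = (fun o => G *m row_mx (calA q) (calD q) *m Z o
           + (g - G *m (calA q *m muk q))).
  apply/funext => o; rewrite -mulmxA mul_row_col /Yvec mulmxBr.
  by rewrite addrAC mulmxBr -addrA [- _ + _]addrC.
have XE' : [set o | dot a (G *m Yvec o + g) <= b] =
    [set o | dot a (G *m row_mx (calA q) (calD q) *m Z o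
                     + (g - G *m (calA q *m muk q))) <= b].
  by apply/seteqP; split=> o /=; have /(congr1 (fun f => f o)) /= -> := XE.
rewrite XE' (gaussian_chanceP GZ)//= -XE.
rewrite mean_affine ?Yvec_mean ?mulmx0 ?add0r; last exact: Yvec_sqint.
rewrite cov_mx_affine ?Yvec_cov; last exact: Yvec_sqint.
rewrite -[psd_sqrt _ *m _ *m a]mulmxA enorm_psd_sqrt; last exact: Sigmay_psd.
by rewrite qform_mulmx trmxK.
Qed.

Lemma closed_loop_rv (z : decision R nx nu N) (x : nat -> Omega -> 'cV[R]_nx)
  (u : nat -> Omega -> 'cV[R]_nu) :
  predicts q k xk w x u -> follows_law q k w z x u ->
  (forall s : 'I_N.+1, x (k + s)%N =
     fun o => Esel R nx s *m IBK q z *m Yvec o + Esel R nx s *m mean_traj q z) /\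
  (forall s : 'I_N, u (k + s)%N =
     fun o => Fsel R nu s *m Kmat z *m Yvec o + Fsel R nu s *m Vvec z).
Proof.
move=> [x0 xS] [y [y0 yS uE]].
have CL o := @closed_loop R nx nu nw N Ns Nc q z (fun s => x (k + s)%N o)
   (fun s => u (k + s)%N o) (fun s => y (k + s)%N o) (fun s => w (k + s)%N o).
have {}CL o : _ := CL o.
split=> s; apply/funext => o.
  have [||||E _] := CL o.
  - by rewrite addn0 y0.
  - by move=> t; rewrite addnS yS.
  - by move=> t; rewrite uE.
  - by move=> t; rewrite addnS xS.
  by rewrite E addn0 x0.
have [||||_ E] := CL o.
- by rewrite addn0 y0.
- by move=> t; rewrite addnS yS.
- by move=> t; rewrite uE.
- by move=> t; rewrite addnS xS.
by rewrite E addn0 x0.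
Qed.

Lemma Yvec_affine_mean n (G : 'M[R]_(n, stk N.+1 nx)) (g : 'cV[R]_n) :
  mean P (fun o => G *m Yvec o + g) = g.
Proof. by rewrite (mean_affine G g Yvec_sqint) Yvec_mean mulmx0 add0r. Qed.

Lemma Yvec_affine_cov n (G : 'M[R]_(n, stk N.+1 nx)) (g : 'cV[R]_n) :
  cov_mx P (fun o => G *m Yvec o + g) = G *m Sigmay q *m G^T.
Proof. by rewrite (cov_mx_affine G g Yvec_sqint) Yvec_cov. Qed.

Lemma Yvec_affine_qform n (M : 'M[R]_n) (G : 'M[R]_(n, stk N.+1 nx)) (g : 'cV[R]_n) :
  (fun o => qform M (G *m Yvec o + g)) \in Lfun P 1%:E /\
  fine ('E_P[fun o => qform M (G *m Yvec o + g)])%E =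
    qform M g + \tr (G^T *m M *m G *m Sigmay q).
Proof.
have [L1 ->] := qform_Lfun M (sqint_affine G g Yvec_sqint); split=> //=.
rewrite Yvec_affine_mean Yvec_affine_cov; congr (_ + _).
by rewrite !mulmxA mxtrace_mulC !mulmxA.
Qed.

Section closed_loop_pair.
Context (z : decision R nx nu N) (x : nat -> Omega -> 'cV[R]_nx)
  (u : nat -> Omega -> 'cV[R]_nu).
Hypotheses (Hp : predicts q k xk w x u) (Hf : follows_law q k w z x u).

Let xE (s : 'I_N.+1) : x (k + s)%N =
  fun o => Esel R nx s *m IBK q z *m Yvec o + Esel R nx s *m mean_traj q z.
Proof. exact: (closed_loop_rv Hp Hf).1. Qed.

Let uE (s : 'I_N) : u (k + s)%N =
  fun o => Fsel R nu s *m Kmat z *m Yvec o + Fsel R nu s *m Vvec z.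
Proof. exact: (closed_loop_rv Hp Hf).2. Qed.

Let xE' (s : 'I_N) : x (k + s)%N = fun o =>
  Esel R nx (widen_ord (leqnSn N) s) *m IBK q z *m Yvec o +
  Esel R nx (widen_ord (leqnSn N) s) *m mean_traj q z.
Proof. exact: (xE (widen_ord (leqnSn N) s)). Qed.

Let QcovE : Qcov q = \sum_(s < N) (Esel R nx (widen_ord (leqnSn N) s))^T *m dQ q *m
  Esel R nx (widen_ord (leqnSn N) s).
Proof.
rewrite /Qcov mxdiag_sum_sel [LHS]big_ord_recr/= ltnn mulmx0 mul0mx addr0.
by apply: eq_bigr => s _; rewrite ltn_ord.
Qed.

Let QmeanE : Qmean q = Qcov q +
  (Esel R nx (@ord_max N))^T *m dPmean q *m Esel R nx ord_max.
Proof.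
rewrite QcovE /Qmean mxdiag_sum_sel [LHS]big_ord_recr/= ltnn; congr (_ + _).
by apply: eq_bigr => s _; rewrite ltn_ord.
Qed.

Lemma closed_loop_cost : ocp_cost P q k x u = (JN q z)%:E.
Proof.
rewrite /ocp_cost.
(* the 2 N stage costs, states first *)
pose f (c : 'I_N + 'I_N) o := match c with
  | inl s => qform (dQ q) (x (k + s)%N o) | inr s => qform (dR q) (u (k + s)%N o) end.
have fL c : f c \in Lfun P 1%:E /\ fine ('E_P[f c])%E = match c with
  | inl s => qform (dQ q) (Esel R nx (widen_ord (leqnSn N) s) *m mean_traj q z) +
     \tr ((IBK q z)^T *m ((Esel R nx (widen_ord (leqnSn N) s))^T *m dQ q *m
         Esel R nx (widen_ord (leqnSn N) s)) *m IBK q z *m Sigmay q)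
  | inr s => qform (dR q) (Fsel R nu s *m Vvec z) +
     \tr ((Kmat z)^T *m ((Fsel R nu s)^T *m dR q *m Fsel R nu s) *m Kmat z *m Sigmay q)
  end.
  case: c => s; rewrite /f ?xE' ?uE.
    by have [? ->] := Yvec_affine_qform (dQ q) (Esel R nx (widen_ord (leqnSn N) s) *m IBK q z)
         (Esel R nx (widen_ord (leqnSn N) s) *m mean_traj q z); rewrite trmx_mul !mulmxA.
  by have [? ->] := Yvec_affine_qform (dR q) (Fsel R nu s *m Kmat z)
         (Fsel R nu s *m Vvec z); rewrite trmx_mul !mulmxA.
have -> : (fun o => \sum_(s < N) (qform (dQ q) (x (k + s)%N o) +
     qform (dR q) (u (k + s)%N o))) = (fun o => \sum_(c : 'I_N + 'I_N) 1 * f c o).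
  apply/funext => o; rewrite big_sumType/= big_split/=.
  by congr (_ + _); apply: eq_bigr => s _; rewrite mul1r.
rewrite expectation_lincomb; last by move=> c; case: (fL c).
rewrite (xE ord_max) Yvec_affine_mean -EFinD; congr EFin.
under eq_bigr => c _ do rewrite mul1r (fL c).2.
rewrite big_sumType/= !big_split/=.
have trS n (G : 'M[R]_(n, stk N.+1 nx)) (M : 'I_N -> 'M[R]_n) :
    \sum_s \tr (G^T *m M s *m G *m Sigmay q) =
    \tr (G^T *m (\sum_s M s) *m G *m Sigmay q).
  by rewrite mulmx_sumr !mulmx_suml raddf_sum.
rewrite !trS -QcovE -mxdiag_sum_sel -/(Rbar q) /JN mulmxDl mxtraceD QmeanE qformD.
rewrite -(qform_mulmx (dPmean q)) QcovE qform_sum -QcovE.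
under eq_bigr do rewrite qform_mulmx.
under [X in _ + (X + _) + _]eq_bigr do rewrite qform_mulmx.
rewrite {3}/Rbar mxdiag_sum_sel qform_sum.
ring.
Qed.

Lemma closed_loop_feasible : ocp_feasible P q k xk w x u <-> program_feasible q z.
Proof.
have pxr := px_range Hq; have pur := pu_range Hq.
have chx (s : 'I_N) i :
  ((1 - px q i)%:E <= P [set o | (dot (alphax q i) (x (k + s)%N o) <= betax q i)%R])%E
  <-> (state_con q s i z <= 0)%E.
  rewrite xE' Yvec_chanceP ?pxr// /state_con trmx_mul -!mulmxA; exact: iff_refl.
have chu (s : 'I_N) j :
  ((1 - pu q j)%:E <= P [set o | (dot (alphau q j) (u (k + s)%N o) <= betau q j)%R])%E
  <-> (input_con q s j z <= 0)%E.
  rewrite uE Yvec_chanceP ?pur// /input_con trmx_mul -!mulmxA; exact: iff_refl.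
have meanN : mean P (x (k + N)%N) = Esel R nx ord_max *m mean_traj q z.
  by rewrite (xE ord_max) Yvec_affine_mean.
have covN : cov_mx P (x (k + N)%N) = Esel R nx ord_max *m IBK q z *m Sigmay q
    *m (IBK q z)^T *m (Esel R nx ord_max)^T.
  by rewrite (xE ord_max) Yvec_affine_cov trmx_mul !mulmxA.
split=> [[_ _ cx cu tm tc]|[cx cu tm tc]].
  split; [by move=> s i; exact/chx|by move=> s j; exact/chu| |].
  - by rewrite /mean_con/= -meanN.
  - by rewrite /cov_con/= -covN.
split=> //.
- by move=> s; rewrite uE; exact: sqint_affine Yvec_sqint.
- by move=> s i; exact/chx.
- by move=> s j; exact/chu.
- by rewrite meanN.
- by rewrite covN.
Qed.

End closed_loop_pair.

End closed_loop_statistics.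

(** * Convexity of the program *)

Section convexity.
Local Open Scope convex_scope.
Context (R : realType) (nx nu nw N Ns Nc : nat) (q : ocp_data R nx nu nw N Ns Nc).
Hypothesis Hq : standing_assumptions q.
Local Notation D := (decision R nx nu N).
Implicit Types (t : {i01 R}) (a b : D).

(** The convex combination of two decisions, named so that it is not unfolded
    componentwise. *)
Definition mix t a b : D := (a : convex_lmodType D) <| t |> (b : convex_lmodType D).

Let t01 t : 0 <= t%:num <= 1.
Proof. by rewrite ge0 le1. Qed.

Lemma Vvec_mix t a b : Vvec (mix t a b) = t%:num *: Vvec a + (1 - t%:num) *: Vvec b.
Proof.
by apply/matrixP => i j; rewrite !mxE /mix /conv/= !ffunE !mxE.
Qed.

Lemma Kmat_mix t a b : Kmat (mix t a b) = t%:num *: Kmat a + (1 - t%:num) *: Kmat b.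
Proof.
apply/matrixP => i j; rewrite !mxE; case: ifP => _; last by rewrite !mxE !mulr0 addr0.
by rewrite /mix /conv/= !ffunE !mxE.
Qed.

Lemma mean_traj_mix t a b : mean_traj q (mix t a b) =
  t%:num *: mean_traj q a + (1 - t%:num) *: mean_traj q b.
Proof.
rewrite /mean_traj Vvec_mix mulmxDr -!scalemxAr !scalerDr addrACA -scalerDl.
by rewrite (addrC t%:num) subrK scale1r.
Qed.

Lemma IBK_mix t a b : IBK q (mix t a b) =
  t%:num *: IBK q a + (1 - t%:num) *: IBK q b.
Proof.
rewrite /IBK Kmat_mix mulmxDr -!scalemxAr !scalerDr addrACA -scalerDl.
by rewrite (addrC t%:num) subrK scale1r.
Qed.

End convexity.

Section quadratic_convexity.
Context (R : realType).

Lemma trmx_lincomb m n (A B : 'M[R]_(m, n)) (s t : R) :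
  (s *: A + t *: B)^T = s *: A^T + t *: B^T.
Proof. by apply/matrixP => i j; rewrite !mxE. Qed.

Lemma qform_delta n (M : 'M[R]_n) j : qform M (delta_mx j 0) = M j j.
Proof. by rewrite /qform trmx_delta -rowE -colE !mxE. Qed.

Lemma tr_qform n m (M : 'M[R]_n) (A : 'M[R]_(n, m)) :
  \tr (A^T *m M *m A) = \sum_j qform M (col j A).
Proof. by apply: eq_bigr => j _; rewrite colE qform_mulmx qform_delta. Qed.

Lemma psd_mxdiag m n (B : 'I_m -> 'M[R]_n) :
  (forall i, psd (B i)) -> psd (\mxdiag_(i < m) B i).
Proof.
move=> B0; rewrite mxdiag_sum_sel; apply: big_ind => [|M1 M2|i _].
- by split=> [|v]; [rewrite trmx0|rewrite /qform mulmx0 mul0mx mxE].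
- exact: psdD.
- exact: psd_congr.
Qed.

(** With a square root [r] of [S], this trace is the sum of [qform M] over the
    columns of [A r]. *)
Lemma tr_quadratic_convex n m (M : 'M[R]_n) (S : 'M[R]_m) (A B : 'M[R]_(n, m)) (t : R) :
  psd M -> psd S -> 0 <= t <= 1 ->
  \tr ((t *: A + (1 - t) *: B)^T *m M *m (t *: A + (1 - t) *: B) *m S) <=
  t * \tr (A^T *m M *m A *m S) + (1 - t) * \tr (B^T *m M *m B *m S).
Proof.
move=> M0 /psd_sqrtP[[rT _] rr] t01.
have E (X : 'M[R]_(n, m)) : \tr (X^T *m M *m X *m S) =
    \sum_j qform M (col j (X *m psd_sqrt S)).
  rewrite -tr_qform trmx_mul rT -!mulmxA [RHS]mxtrace_mulC !mulmxA.
  by rewrite -[in RHS](mulmxA _ (psd_sqrt S)) rr.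
rewrite !E !mulr_sumr -big_split/=; apply: ler_sum => j _.
rewrite mulmxDl -!scalemxAl [col _ (_ + _)]linearD/= ![col _ (_ *: _)]linearZ/=.
exact: (qform_convex _ _ M0 t01).
Qed.

End quadratic_convexity.

Section program_convexity.
Local Open Scope convex_scope.
Context (R : realType) (nx nu nw N Ns Nc : nat) (q : ocp_data R nx nu nw N Ns Nc).
Hypothesis Hq : standing_assumptions q.
Local Notation D := (decision R nx nu N).
Implicit Types (t : {i01 R}) (a b : D).

Let t01 t : 0 <= t%:num <= 1.
Proof. by rewrite ge0 le1. Qed.

Lemma JN_convex : @convex_function R D setT (JN q).
Proof.
move=> t a b _ _; rewrite -[_ <| _ |> _]/(mix t a b) convRE /JN !mulmxDl !mxtraceD.
have Qc : psd (Qcov q).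
  apply: psd_mxdiag => i; case: ifP => _; first exact: Q_psd Hq.
  by split=> [|v]; [rewrite trmx0|rewrite /qform mulmx0 mul0mx mxE].
have Qm : psd (Qmean q).
  by apply: psd_mxdiag => i; case: ifP => _; [exact: Q_psd Hq|exact/pd_psd/Pmean_pd].
have Rb : psd (Rbar q) by apply: psd_mxdiag => i; exact/pd_psd/R_pd.
have Sy := Sigmay_psd Hq.
rewrite IBK_mix Kmat_mix mean_traj_mix Vvec_mix.
have := tr_quadratic_convex (IBK q a) (IBK q b) Qc Sy (t01 t).
have := tr_quadratic_convex (Kmat a) (Kmat b) Rb Sy (t01 t).
have := qform_convex (mean_traj q a) (mean_traj q b) Qm (t01 t).
have := qform_convex (Vvec a) (Vvec b) Rb (t01 t).
rewrite /unstable.onem /=; lra.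
Qed.

(** With [z = +oo] the bound still holds, because a nonzero deviation [n0] on the
    left forces a nonzero [t * n1] or [(1 - t) * n2] on the right. *)
Lemma chance_convex (D0 D1 D2 n0 n1 n2 beta t : R) (z : \bar R) :
  (0 <= z)%E -> 0 <= t <= 1 -> D0 = t * D1 + (1 - t) * D2 ->
  0 <= n0 -> 0 <= n1 -> 0 <= n2 -> n0 <= t * n1 + (1 - t) * n2 ->
  (D0%:E + n0%:E * z - beta%:E <=
   t%:E * (D1%:E + n1%:E * z - beta%:E) +
   (1 - t)%:E * (D2%:E + n2%:E * z - beta%:E))%E.
Proof.
move=> z0 /andP[t0 t1] -> n00 n10 n20 n012.
case: z z0 => [z| |]// z0.
  rewrite -!(EFinM, EFinD, EFinN) lee_fin; rewrite lee_fin in z0.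
  have := ler_wpM2r z0 n012; lra.
have split_term s D' n' : 0 <= s -> 0 <= n' ->
    (s%:E * (D'%:E + n'%:E * +oo - beta%:E) = (s * (D' - beta))%:E + (s * n')%:E * +oo)%E.
  move=> s0 n'0; have [->|n'N0] := eqVneq n' 0.
    by rewrite mulr0 !mul0e !adde0 -EFinB -EFinM.
  have n'p : 0 < n' by rewrite lt_neqAle eq_sym n'N0.
  have [->|sN0] := eqVneq s 0; first by rewrite !mul0r !mul0e adde0.
  have sp : 0 < s by rewrite lt_neqAle eq_sym sN0.
  by rewrite !gt0_muley ?lte_fin ?mulr_gt0// !(addey, addye)// gt0_muley ?lte_fin.
have := @split_term 1 (t * D1 + (1 - t) * D2) n0 ler01 n00.
rewrite mul1e => ->; rewrite !split_term ?subr_ge0// !mul1r.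
rewrite addeACA -EFinD -ge0_muleDl ?lee_fin ?mulr_ge0 ?subr_ge0// -EFinD.
apply: leeD; first by rewrite lee_fin; lra.
by apply: lee_wpmul2r; rewrite ?lee_fin// leey.
Qed.

Let deviation_convex m n (G Ga Gb : 'M[R]_(m, n)) (S : 'M[R]_n) (v : 'cV[R]_m) (t : R) :
  0 <= t <= 1 -> G = t *: Ga + (1 - t) *: Gb ->
  enorm (S *m G^T *m v) <= t * enorm (S *m Ga^T *m v) + (1 - t) * enorm (S *m Gb^T *m v).
Proof.
move=> /andP[t0 t1] ->; rewrite trmx_lincomb mulmxDr mulmxDl.
rewrite -!scalemxAr -!scalemxAl -!enormZ ?subr_ge0//; exact: enormD.
Qed.

Let dot_mix n (v g ga gb : 'cV[R]_n) (t : R) : g = t *: ga + (1 - t) *: gb ->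
  dot v g = t * dot v ga + (1 - t) * dot v gb.
Proof. by move=> ->; rewrite /dot mulmxDr -!scalemxAr !mxE. Qed.

Lemma state_con_convex s i : @convex_efunction R D (state_con q s i).
Proof.
move=> t a b; rewrite -[_ <| _ |> _]/(mix t a b) /state_con.
apply: chance_convex; rewrite ?enorm_ge0//.
- by case: (Phi_invP (px_range Hq i)).
- apply: dot_mix; rewrite mean_traj_mix mulmxDr -!scalemxAr//.
- rewrite -!mulmxA; rewrite !(mulmxA (psd_sqrt _)).
  apply: deviation_convex => //; exact: IBK_mix.
Qed.

Lemma input_con_convex s j : @convex_efunction R D (input_con q s j).
Proof.
move=> t a b; rewrite -[_ <| _ |> _]/(mix t a b) /input_con.
apply: chance_convex; rewrite ?enorm_ge0//.
- by case: (Phi_invP (pu_range Hq j)).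
- apply: dot_mix; rewrite Vvec_mix mulmxDr -!scalemxAr//.
- rewrite -!mulmxA; rewrite !(mulmxA (psd_sqrt _)).
  apply: deviation_convex => //; exact: Kmat_mix.
Qed.

(** Along every [v] the constraint bounds the convex function
    [qform (Sigmay q) ((IBK q z)^T E_N^T v)] of [z]. *)
Lemma cov_con_convex : @convex_set R D (cov_con q).
Proof.
move=> a b t /set_mem[_ a0] /set_mem[_ b0]; apply/mem_set.
suff: cov_con q (mix t a b) by [].
have [ST _] := Sigmay_psd Hq; have [fT _] := Sigmaf_pd Hq.
split=> [|v].
  by rewrite linearB/= !trmx_mul !trmxK ST fT !mulmxA.
have E c : qform (Sigmaf q - Esel R nx ord_max *m IBK q c *m Sigmay q *m (IBK q c)^T
    *m (Esel R nx ord_max)^T) v =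
    qform (Sigmaf q) v - qform (Sigmay q) ((IBK q c)^T *m ((Esel R nx ord_max)^T *m v)).
  by rewrite qformD qformN [X in _ = _ - X]qform_mulmx qform_mulmx !trmxK !mulmxA.
move: (a0 v) (b0 v); rewrite !E IBK_mix trmx_lincomb mulmxDl -!scalemxAl.
have := qform_convex ((IBK q a)^T *m ((Esel R nx ord_max)^T *m v))
  ((IBK q b)^T *m ((Esel R nx ord_max)^T *m v)) (Sigmay_psd Hq) (t01 t).
move=> h ha hb; have /andP[t0 t1] := t01 t.
have t1' : 0 <= 1 - t%:num by rewrite subr_ge0.
have := mulr_ge0 t0 ha; have := mulr_ge0 t1' hb; lra.
Qed.

Lemma mean_con_convex : convex_set (Xf q) -> @convex_set R D (mean_con q).
Proof.
move=> cX a b t /set_mem ha /set_mem hb; apply/mem_set.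
suff: mean_con q (mix t a b) by [].
rewrite /mean_con/= mean_traj_mix mulmxDr -!scalemxAr.
exact: (set_mem (cX _ _ t (mem_set ha) (mem_set hb))).
Qed.

Lemma program_convex : convex_set (Xf q) -> @convex_set R D (program_feasible q).
Proof.
move=> cX a b t /set_mem[ax au am ac] /set_mem[bx bu bm bc]; apply/mem_set.
have ecombine (f : D -> \bar R) : @convex_efunction R D f ->
    (f a <= 0)%E -> (f b <= 0)%E -> (f (mix t a b) <= 0)%E.
  move=> cf fa fb; apply: (le_trans (cf t a b)).
  by apply: adde_le0; apply: mule_ge0_le0 => //; rewrite lee_fin ?subr_ge0 ?le1 ?ge0.
split.
- by move=> s i; apply: ecombine; [exact: state_con_convex|exact: ax|exact: bx].
- by move=> s j; apply: ecombine; [exact: input_con_convex|exact: au|exact: bu].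
- by apply: set_mem; apply: (mean_con_convex cX); exact: mem_set.
- by apply: set_mem; apply: cov_con_convex; exact: mem_set.
Qed.

End program_convexity.

(** * Correspondence of decisions and closed loops *)

Section simulation.
Context {Omega : Type} {R : realType} {nx nu nw N Ns Nc : nat}.
Context (q : ocp_data R nx nu nw N Ns Nc) (k : nat).
Context (xk : Omega -> 'cV[R]_nx) (w : nat -> Omega -> 'cV[R]_nw).
Context (z : decision R nx nu N).

Fixpoint sim_y s o : 'cV[R]_nx := if s is s'.+1 then
  dA q *m sim_y s' o + dD q *m w (k + s')%N o else xk o - muk q.

(** Time runs over all of [nat]; the value 0 is reached only from [N] on. *)
Definition sim_u s o : 'cV[R]_nu :=
  if insub s is Some i then z.1 i + z.2 i *m sim_y s o else 0.

Fixpoint sim_x s o : 'cV[R]_nx := if s is s'.+1 then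
  dA q *m sim_x s' o + dB q *m sim_u s' o + dD q *m w (k + s')%N o else xk o.

End simulation.

Lemma closed_loop_exists d (Omega : measurableType d) (R : realType)
    (nx nu nw N Ns Nc : nat) (q : ocp_data R nx nu nw N Ns Nc) k
    (xk : Omega -> 'cV[R]_nx) (w : nat -> Omega -> 'cV[R]_nw) z :
  exists x u, predicts q k xk w x u /\ follows_law q k w z x u.
Proof.
exists (fun t => sim_x q k xk w z (t - k)), (fun t => sim_u q k xk w z (t - k)).
split; first split.
- by rewrite subnn.
- by move=> s; rewrite -addnS !addKn.
exists (fun t => sim_y q k xk w (t - k)); split.
- by rewrite subnn.
- by move=> s; rewrite -addnS !addKn.
- by move=> s; apply/funext => o; rewrite addKn /sim_u valK.
Qed.

Theorem theorem2 (d : measure_display) (Omega : measurableType d)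
    (R : realType) (P : probability Omega R)
    (nx nu nw N Ns Nc : nat) (q : ocp_data R nx nu nw N Ns Nc)
    (k : nat) (xk : Omega -> 'cV[R]_nx) (w : nat -> Omega -> 'cV[R]_nw)
    (Hq : standing_assumptions q)
    (Hxk : gaussian_vector P xk (muk q) (Sigmak q))
    (Hw : gaussian_white_noise P k w)
    (Hxw : forall t, (k <= t)%N -> cross_moment P xk (w t) = 0)
    (Hjoint : exists m S, gaussian_vector P
       (fun o => col_mx (xk o) (\mxcol_(s < N) w (k + s)%N o)) m S) :
  let ocp_law : set ((nat -> Omega -> 'cV[R]_nx) * (nat -> Omega -> 'cV[R]_nu)) :=
    [set xu | ocp_feasible P q k xk w xu.1 xu.2 /\
              exists z, follows_law q k w z xu.1 xu.2] in
  let cost xu := ocp_cost P q k xu.1 xu.2 in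
  [/\ forall z, exists x u, predicts q k xk w x u /\ follows_law q k w z x u,
      forall z x u, predicts q k xk w x u -> follows_law q k w z x u ->
        [/\ ocp_cost P q k x u = (JN q z)%:E,
            ocp_feasible P q k xk w x u <-> program_feasible q z
          & minimizer ocp_law cost (x, u) <->
            minimizer (program_feasible q) (fun z => (JN q z)%:E) z],
      ereal_inf (cost @` ocp_law) =
        ereal_inf ((fun z => (JN q z)%:E) @` program_feasible q)
    & [/\ convex_function setT (JN q),
          forall s i, convex_efunction (state_con q s i),
          forall s j, convex_efunction (input_con q s j),
          convex_set (cov_con q)
        & convex_set (Xf q) ->
          convex_set (mean_con q) /\ convex_set (program_feasible q)]].
Proof.
move=> ocp_law cost.
have ex := closed_loop_exists q k xk w.
have costE z x u : predicts q k xk w x u -> follows_law q k w z x u ->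
    ocp_cost P q k x u = (JN q z)%:E.
  by move=> xp xf; exact: (closed_loop_cost Hq Hxk Hw Hxw xp xf).
have feasE z x u : predicts q k xk w x u -> follows_law q k w z x u ->
    ocp_feasible P q k xk w x u <-> program_feasible q z.
  by move=> xp xf; exact: (closed_loop_feasible Hq Hxk Hw Hxw Hjoint xp xf).
(* Feasible decisions and feasible pairs correspond to each other with equal
   costs; hence the same values and the same minimizers. *)
have lift z : program_feasible q z -> exists2 xu, ocp_law xu & cost xu = (JN q z)%:E.
  move=> zf; have [x [u [xp xl]]] := ex z; exists (x, u); last exact: costE xp xl.
  by split; [exact/(feasE z)|exists z].
have drop xu : ocp_law xu -> exists2 z, program_feasible q z & cost xu = (JN q z)%:E.
  move=> [xf [z xl]]; have xp := ocp_dynamics xf.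
  by exists z; [exact/(feasE _ _ _ xp xl)|exact: costE].
split=> //.
- move=> z x u xp xl; split; [exact: costE|exact: feasE|].
  have cE : cost (x, u) = (JN q z)%:E by exact: costE.
  split=> -[feas opt].
    split; first by apply/(feasE _ _ _ xp xl); case: feas.
    by move=> b /lift[xu xuf <-]; rewrite -cE; exact: opt.
  split; first by split; [exact/(feasE _ _ _ xp xl)|exists z].
  by move=> xu /drop[b bf ->]; rewrite cE; exact: opt.
- congr ereal_inf; apply/seteqP; split=> c [].
    by move=> xu /drop[z zf ->] <-; exists z.
  by move=> z /lift[xu xuf <-] <-; exists xu.
- split.
  + exact: JN_convex Hq.
  + exact: state_con_convex Hq.
  + exact: input_con_convex Hq.
  + exact: cov_con_convex Hq.
  + by move=> cX; split; [exact: mean_con_convex|exact: program_convex].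
Qed.
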